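(* Consider the 2D bound-preserving (BP) active flux method described in the context: the limited forward-Euler step $\mathcal S$ (limited cell-average update and limited point-value update), advanced in time by the SSP-RK3 scheme. Suppose the initial degrees of freedom satisfy $\overline{\mathbf U}^0_{i,j}\in\mathcal G$ and $\mathbf U^0_\sigma\in\mathcal G$ for all $i,j,\sigma$, and that the time step size satisfies the two constraints (T1) and (T2) stated in the context (at every forward-Euler stage). Then: (a) (Scalar case.) For the scalar conservation law, the method with the scalar cell-average limiting and the scalar point-value limiting of the context preserves the maximum principle: at every later time level $n$, $m_0\le \bar u^n_{i,j}\le M_0$ and $m_0\le u^n_\sigma\le M_0$ for all $i,j,\sigma$. (b) (Euler case.) For the compressible Euler equations, the method with the Euler cell-average limiting and the Euler point-value limiting of the context preserves positive density and pressure: at every later time level $n$, all cell averages $\overline{\mathbf U}^n_{i,j}$ and all point values $\mathbf U^n_\sigma$ have positive density and positive pressure.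
   Context: **Equations.** $\mathbf U_t+\mathbf F_1(\mathbf U)_x+\mathbf F_2(\mathbf U)_y=0$, $\mathbf U(x,y,0)=\mathbf U_0(x,y)$. Two cases: - Scalar: $u_t+f_1(u)_x+f_2(u)_y=0$, $u(\cdot,0)=u_0$, with $\mathcal G=\{u: m_0\le u\le M_0\}$, $m_0=\min u_0$, $M_0=\max u_0$. - Euler: $\mathbf U=(\rho,\rho \mathbf v,E)^\top$, $\mathbf v=(v_1,v_2)$, $\mathbf F_1=(\rho v_1,\rho v_1^2+p,\rho v_1v_2,(E+p)v_1)^\top$, $\mathbf F_2=(\rho v_2,\rho v_1v_2,\rho v_2^2+p,(E+p)v_2)^\top$, $p=(\gamma-1)(E-\|\rho\mathbf v\|^2/(2\rho))$, $\gamma>1$, with $\mathcal G=\{\mathbf U:\rho>0,\ p>0\}$. $\varrho_\ell(\mathbf U)$ is the spectral radius of $\partial\mathbf F_\ell/\partial\mathbf U$. For states $\mathbf V,\mathbf W$ put $a_\ell(\mathbf V,\mathbf W)=\max\{\varrho_\ell(\mathbf V),\varrho_\ell(\mathbf W)\}$ and define the local Lax-Friedrichs (LLF) flux $$\widehat{\mathbf F}_\ell^{LLF}(\mathbf V,\mathbf W)=\tfrac12(\mathbf F_\ell(\mathbf V)+\mathbf F_\ell(\mathbf W))-\tfrac12a_\ell(\mathbf V,\mathbf W)(\mathbf W-\mathbf V).$$ All LLF viscosity coefficients that occur are assumed positive. **Mesh and degrees of freedom (DoFs).** Cells $I_{i,j}=[x_{i-1/2},x_{i+1/2}]\times[y_{j-1/2},y_{j+1/2}]$,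 $1\le i\le N_1$, $1\le j\le N_2$, with sizes $\Delta x_i,\Delta y_j$ and centers $(x_i,y_j)$. DoFs: cell averages $\overline{\mathbf U}_{i,j}$ and point values $\mathbf U_\sigma$, where $\sigma$ ranges over corners $(x_{i+1/2},y_{j+1/2})$, vertical face centers $(x_{i+1/2},y_j)$ and horizontal face centers $(x_i,y_{j+1/2})$; these point values are written $\mathbf U_{i+1/2,j+1/2},\mathbf U_{i+1/2,j},\mathbf U_{i,j+1/2}$. Values outside the mesh come from ghost cells according to the boundary conditions (e.g. periodic), belong to $\mathcal G$, and are included among ''all DoFs''. **Semi-discrete active flux method.** $$\frac{d\overline{\mathbf U}_{i,j}}{dt}=-\frac1{\Delta x_i}(\widehat{\mathbf F}^H_{i+1/2,j}-\widehat{\mathbf F}^H_{i-1/2,j})-\frac1{\Delta y_j}(\widehat{\mathbf F}^H_{i,j+1/2}-\widehat{\mathbf F}^H_{i,j-1/2}),\qquad \frac{d\mathbf U_\sigma}{dt}=-\mathcal R_\sigma,$$ where $\widehat{\mathbf F}^H_{i+1/2,j}$ is the average over the face of $\mathbf F_1(\mathbf U_h)$, e.g. by Simpson's rule $\frac16(\mathbf F_1(\mathbf U_{i+1/2,j-1/2})+4\mathbf F_1(\mathbf U_{i+1/2,j})+\mathbf F_1(\mathbf U_{i+1/2,j+1/2}))$, $\widehat{\mathbf F}^H_{i,j+1/2}$ is analogous with $\mathbf F_2$, and $\mathcal R_\sigma$ is a consistent approximation of $\partial_x\mathbf F_1+\partial_y\mathbf F_2$ at $\sigma$, a given function of cell averages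 and point values in a stencil around $\sigma$, well defined for DoFs in $\mathcal G$. **Limited forward-Euler step $\mathcal S$** (step size $\Delta t^n$, input DoFs with superscript $n$). *Low-order quantities.* $(\alpha_1)_{i+1/2,j}=a_1(\overline{\mathbf U}^n_{i,j},\overline{\mathbf U}^n_{i+1,j})$, $\widehat{\mathbf F}^L_{i+1/2,j}=\widehat{\mathbf F}^{LLF}_1(\overline{\mathbf U}^n_{i,j},\overline{\mathbf U}^n_{i+1,j})$, $$\widetilde{\mathbf U}_{i+1/2,j}=\tfrac12(\overline{\mathbf U}^n_{i,j}+\overline{\mathbf U}^n_{i+1,j})+\frac1{2(\alpha_1)_{i+1/2,j}}\left[\mathbf F_1(\overline{\mathbf U}^n_{i,j})-\mathbf F_1(\overline{\mathbf U}^n_{i+1,j})\right],$$ and $\Delta\widehat{\mathbf F}_{i+1/2,j}=\widehat{\mathbf F}^H_{i+1/2,j}-\widehat{\mathbf F}^L_{i+1/2,j}$. The quantities with index $(i,j+\frac12)$ are defined analogously in the $y$-direction, with $\alpha_2,\mathbf F_2$. *Cell average:* $$\overline{\mathbf U}_{i,j}^{new}=\overline{\mathbf U}^n_{i,j}-\frac{\Delta t^n}{\Delta x_i}(\widehat{\mathbf F}^{Lim}_{i+1/2,j}-\widehat{\mathbf F}^{Lim}_{i-1/2,j})-\frac{\Delta t^n}{\Delta y_j}(\widehat{\mathbf F}^{Lim}_{i,j+1/2}-\widehat{\mathbf F}^{Lim}_{i,j-1/2}),$$ with limited fluxes as follows ($x$-direction shown; $y$-direction analogous). - Scalar cell-average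 limiting: $\hat f^{Lim}_{i+1/2,j}=\hat f^L_{i+1/2,j}+\Delta\hat f^{Lim}_{i+1/2,j}$. If $\Delta\hat f_{i+1/2,j}\ge0$, $$\Delta\hat f^{Lim}_{i+1/2,j}=\min\{\Delta\hat f_{i+1/2,j},\ (\alpha_1)_{i+1/2,j}\min\{\tilde u_{i+1/2,j}-u^{\min}_{i,j},\,u^{\max}_{i+1,j}-\tilde u_{i+1/2,j}\}\},$$ otherwise $$\Delta\hat f^{Lim}_{i+1/2,j}=\max\{\Delta\hat f_{i+1/2,j},\ (\alpha_1)_{i+1/2,j}\max\{u^{\min}_{i+1,j}-\tilde u_{i+1/2,j},\,\tilde u_{i+1/2,j}-u^{\max}_{i,j}\}\}.$$ Here $u^{\min}_{i,j}=\min\mathcal N$, $u^{\max}_{i,j}=\max\mathcal N$, where $\mathcal N$ is either the set of all DoFs $\bar u^n,u^n_\sigma$ (global), or (local) $\{\bar u^n_{i,j},\tilde u_{i\pm1/2,j},\tilde u_{i,j\pm1/2},\bar u^n_{i\pm1,j},\bar u^n_{i,j\pm1}\}$. - Euler cell-average limiting. Superscripts $\rho,\rho\mathbf v,E$ denote components. Let $\varepsilon^\rho,\varepsilon^p$ be the minimum density and pressure over all DoFs at level $n$; $\varepsilon^\rho_{i,j}=\min\{10^{-13},\varepsilon^\rho,\widetilde{\mathbf U}^\rho_{i\pm1/2,j},\widetilde{\mathbf U}^\rho_{i,j\pm1/2}\}$; $\varepsilon^p_{i,j}=\min\{10^{-13},\varepsilon^p,p(\widetilde{\mathbf U}_{i\pm1/2,j}),p(\widetilde{\mathbf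 U}_{i,j\pm1/2})\}$; $\bar\varepsilon^{\rho}=\min\{\varepsilon^\rho_{i,j},\varepsilon^\rho_{i+1,j}\}$, $\bar\varepsilon^{p}=\min\{\varepsilon^p_{i,j},\varepsilon^p_{i+1,j}\}$. Dropping the index $(i+\frac12,j)$ and writing $\alpha_1=(\alpha_1)_{i+1/2,j}$: 1. $\Delta\widehat{\mathbf F}^{Lim,\rho}=\min\{\Delta\widehat{\mathbf F}^\rho,\alpha_1(\widetilde{\mathbf U}^\rho-\bar\varepsilon^\rho)\}$ if $\Delta\widehat{\mathbf F}^\rho\ge0$, else $\max\{\Delta\widehat{\mathbf F}^\rho,\alpha_1(\bar\varepsilon^\rho-\widetilde{\mathbf U}^\rho)\}$. Let $\widehat{\mathbf F}^{*}$ have density component $\widehat{\mathbf F}^{L,\rho}+\Delta\widehat{\mathbf F}^{Lim,\rho}$ and other components equal to those of $\widehat{\mathbf F}^H$. Put $\mathbf D=\widehat{\mathbf F}^{*}-\widehat{\mathbf F}^L$. 2. With $\tilde\varepsilon=\bar\varepsilon^p/(\gamma-1)$ put $A=\frac12\|\mathbf D^{\rho\mathbf v}\|_2^2-\mathbf D^\rho\mathbf D^E$, $B=\alpha_1(\mathbf D^\rho\widetilde{\mathbf U}^E+\widetilde{\mathbf U}^\rho\mathbf D^E-\mathbf D^{\rho\mathbf v}\cdot\widetilde{\mathbf U}^{\rho\mathbf v}-\tilde\varepsilon\mathbf D^\rho)$, $C=\alpha_1^2(\widetilde{\mathbf U}^\rho\widetilde{\mathbf U}^E-\frac12\|\widetilde{\mathbf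 U}^{\rho\mathbf v}\|_2^2-\tilde\varepsilon\widetilde{\mathbf U}^\rho)$, $\theta=\min\{1,C/(\max\{0,A\}+|B|)\}$ ($\theta=1$ if the denominator is $0$). The limited flux is $\widehat{\mathbf F}^{Lim}=\widehat{\mathbf F}^L+\theta\mathbf D$. *Point values.* High-order value $\mathbf U^H_\sigma=\mathbf U^n_\sigma-\Delta t^n\mathcal R_\sigma$. Low-order values (all right-hand sides at level $n$): $$\mathbf U^L_{i+1/2,j+1/2}=\mathbf U_{i+1/2,j+1/2}-\tfrac{2\Delta t^n}{\Delta x_i+\Delta x_{i+1}}\left[\widehat{\mathbf F}_1^{LLF}(\mathbf U_{i+1/2,j+1/2},\mathbf U_{i+3/2,j+1/2})-\widehat{\mathbf F}_1^{LLF}(\mathbf U_{i-1/2,j+1/2},\mathbf U_{i+1/2,j+1/2})\right]-\tfrac{2\Delta t^n}{\Delta y_j+\Delta y_{j+1}}\left[\widehat{\mathbf F}_2^{LLF}(\mathbf U_{i+1/2,j+1/2},\mathbf U_{i+1/2,j+3/2})-\widehat{\mathbf F}_2^{LLF}(\mathbf U_{i+1/2,j-1/2},\mathbf U_{i+1/2,j+1/2})\right],$$ $$\mathbf U^L_{i+1/2,j}=\mathbf U_{i+1/2,j}-\tfrac{2\Delta t^n}{\Delta x_i+\Delta x_{i+1}}\left[\widehat{\mathbf F}_1^{LLF}(\mathbf U_{i+1/2,j},\mathbf U_{i+3/2,j})-\widehat{\mathbf F}_1^{LLF}(\mathbf U_{i-1/2,j},\mathbf U_{i+1/2,j})\right]-\tfrac{\Delta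 t^n}{\Delta y_j}\left[\widehat{\mathbf F}_2^{LLF}(\mathbf U_{i+1/2,j},\mathbf U_{i+1/2,j+1/2})-\widehat{\mathbf F}_2^{LLF}(\mathbf U_{i+1/2,j-1/2},\mathbf U_{i+1/2,j})\right],$$ $$\mathbf U^L_{i,j+1/2}=\mathbf U_{i,j+1/2}-\tfrac{\Delta t^n}{\Delta x_i}\left[\widehat{\mathbf F}_1^{LLF}(\mathbf U_{i,j+1/2},\mathbf U_{i+1/2,j+1/2})-\widehat{\mathbf F}_1^{LLF}(\mathbf U_{i-1/2,j+1/2},\mathbf U_{i,j+1/2})\right]-\tfrac{2\Delta t^n}{\Delta y_j+\Delta y_{j+1}}\left[\widehat{\mathbf F}_2^{LLF}(\mathbf U_{i,j+1/2},\mathbf U_{i,j+3/2})-\widehat{\mathbf F}_2^{LLF}(\mathbf U_{i,j-1/2},\mathbf U_{i,j+1/2})\right].$$ - Scalar point-value limiting: $u^{new}_\sigma=\theta_\sigma u^H_\sigma+(1-\theta_\sigma)u^L_\sigma$, $\theta_\sigma=\min\left\{1,\left|\frac{u^L_\sigma-u^{\min}_\sigma}{u^L_\sigma-u^H_\sigma}\right|,\left|\frac{u^{\max}_\sigma-u^L_\sigma}{u^H_\sigma-u^L_\sigma}\right|\right\}$ ($\theta_\sigma=1$ if $u^H_\sigma=u^L_\sigma$), with $u_\sigma^{\min}=\min\mathcal N$, $u_\sigma^{\max}=\max\mathcal N$, where $\mathcal N$ is the set of all DoFs at level $n$ (global) or the set of the five point values at level $n$ appearing in the formula for $u^L_\sigma$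 (local). - Euler point-value limiting: let $\varepsilon^\rho_\sigma=\min\{10^{-13},\varepsilon^\rho,\mathbf U^{L,\rho}_\sigma\}$, $\varepsilon^p_\sigma=\min\{10^{-13},\varepsilon^p,p(\mathbf U^L_\sigma)\}$. Put $\theta^*_\sigma=\frac{\mathbf U^{L,\rho}_\sigma-\varepsilon^\rho_\sigma}{\mathbf U^{L,\rho}_\sigma-\mathbf U^{H,\rho}_\sigma}$ if $\mathbf U^{H,\rho}_\sigma<\varepsilon^\rho_\sigma$, else $1$. Let $\mathbf U^{*}_\sigma$ have density $\theta^*_\sigma\mathbf U^{H,\rho}_\sigma+(1-\theta^*_\sigma)\mathbf U^{L,\rho}_\sigma$ and other components those of $\mathbf U^H_\sigma$. Put $\theta^{**}_\sigma=\frac{p(\mathbf U^L_\sigma)-\varepsilon^p_\sigma}{p(\mathbf U^L_\sigma)-p(\mathbf U^{*}_\sigma)}$ if $p(\mathbf U^{*}_\sigma)<\varepsilon^p_\sigma$, else $1$. Then $\mathbf U^{new}_\sigma=\theta^{**}_\sigma\mathbf U^{*}_\sigma+(1-\theta^{**}_\sigma)\mathbf U^L_\sigma$. **SSP-RK3.** With $\mathbf U$ the vector of all DoFs: $\mathbf U^*=\mathcal S(\mathbf U^n)$, $\mathbf U^{**}=\frac34\mathbf U^n+\frac14\mathcal S(\mathbf U^* )$, $\mathbf U^{n+1}=\frac13\mathbf U^n+\frac23\mathcal S(\mathbf U^{**})$, with the same $\Delta t^n$ in each stage. **Time step constraints** (for all $i,j$, evaluated at the input of each stage): (T1) $\Delta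 t^n\le\frac12\min\left\{\frac{\Delta x_i}{(\alpha_1)_{i-1/2,j}+(\alpha_1)_{i+1/2,j}},\frac{\Delta y_j}{(\alpha_2)_{i,j-1/2}+(\alpha_2)_{i,j+1/2}}\right\}$. (T2) $\Delta t^n\le\frac12\min$ of the six quantities $\frac{\Delta x_i+\Delta x_{i+1}}{2[a_1(\mathbf U_{i-1/2,j+1/2},\mathbf U_{i+1/2,j+1/2})+a_1(\mathbf U_{i+1/2,j+1/2},\mathbf U_{i+3/2,j+1/2})]}$, $\frac{\Delta y_j+\Delta y_{j+1}}{2[a_2(\mathbf U_{i+1/2,j-1/2},\mathbf U_{i+1/2,j+1/2})+a_2(\mathbf U_{i+1/2,j+1/2},\mathbf U_{i+1/2,j+3/2})]}$, $\frac{\Delta x_i+\Delta x_{i+1}}{2[a_1(\mathbf U_{i-1/2,j},\mathbf U_{i+1/2,j})+a_1(\mathbf U_{i+1/2,j},\mathbf U_{i+3/2,j})]}$, $\frac{\Delta y_j}{a_2(\mathbf U_{i+1/2,j},\mathbf U_{i+1/2,j+1/2})+a_2(\mathbf U_{i+1/2,j-1/2},\mathbf U_{i+1/2,j})}$, $\frac{\Delta x_i}{a_1(\mathbf U_{i,j+1/2},\mathbf U_{i+1/2,j+1/2})+a_1(\mathbf U_{i-1/2,j+1/2},\mathbf U_{i,j+1/2})}$, $\frac{\Delta y_j+\Delta y_{j+1}}{2[a_2(\mathbf U_{i,j-1/2},\mathbf U_{i,j+1/2})+a_2(\mathbf U_{i,j+1/2},\mathbf U_{i,j+3/2})]}$.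
   Formalization: In the scalar case the fluxes are assumed differentiable on [m0,M0] with |f'(u)| ≤ max{|f'(v)|,|f'(w)|} for u between v,w in [m0,M0] (true for convex or concave fluxes); without this the LLF states can leave the range and the claim fails. *)

(* Defs.v *)
From HB Require Import structures.
From mathcomp Require Import all_boot all_order all_algebra.
From mathcomp Require Import complex.
From mathcomp Require Import all_classical all_reals all_analysis.

Set Implicit Arguments.
Unset Strict Implicit.
Unset Printing Implicit Defensive.

Import Order.TTheory GRing.Theory Num.Theory.
Import numFieldNormedType.Exports.
Local Open Scope ring_scope.

(* Minimum and maximum of the finite set consisting of x and the entries
   of s. *)
Definition minl (R : realType) (x : R) (s : seq R) : R :=
  \big[Num.min/x]_(y <- s) y.
Definition maxl (R : realType) (x : R) (s : seq R) : R :=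
  \big[Num.max/x]_(y <- s) y.

(* The mesh cells are I_{i,j}, 1 <= i <= N1, 1 <= j <= N2; they are surrounded
   by ng layers of ghost cells.  xf i stands for x_{i+1/2} and yf j for
   y_{j+1/2}.  Only indices in the ghost-extended window are ever used; two
   layers are needed because the limiting at a boundary face uses the
   quantities attached to the adjacent ghost cell. *)
Record mesh (R : realType) := Mesh {
  N1 : nat;
  N2 : nat;
  ng : nat;
  xf : int -> R;
  yf : int -> R;
  N1_gt0 : (0 < N1)%N;
  N2_gt0 : (0 < N2)%N;
  ng_ge2 : (2 <= ng)%N;
  xf_incr : forall i, xf (i - 1) < xf i;
  yf_incr : forall j, yf (j - 1) < yf j }.

Definition dx (R : realType) (m : mesh R) (i : int) : R :=
  xf m i - xf m (i - 1).
Definition dy (R : realType) (m : mesh R) (j : int) : R :=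
  yf m j - yf m (j - 1).

(* Locations of the point values:
   Corner i j = (x_{i+1/2}, y_{j+1/2}), VFace i j = (x_{i+1/2}, y_j),
   HFace i j = (x_i, y_{j+1/2}). *)
Inductive point := Corner of int & int | VFace of int & int | HFace of int & int.

(* Nearest points on the same horizontal (resp. vertical) line that carry a
   point value and enter the low-order scheme: for Corner and VFace the
   horizontal neighbours are a full cell away, for HFace half a cell. *)
Definition east (s : point) : point :=
  match s with
  | Corner i j => Corner (i + 1) j
  | VFace i j => VFace (i + 1) j
  | HFace i j => Corner i j
  end.
Definition west (s : point) : point :=
  match s with
  | Corner i j => Corner (i - 1) j
  | VFace i j => VFace (i - 1) j
  | HFace i j => Corner (i - 1) j
  end.
Definition north (s : point) : point :=
  match s with
  | Corner i j => Corner i (j + 1)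
  | VFace i j => Corner i j
  | HFace i j => HFace i (j + 1)
  end.
Definition south (s : point) : point :=
  match s with
  | Corner i j => Corner i (j - 1)
  | VFace i j => Corner i (j - 1)
  | HFace i j => HFace i (j - 1)
  end.

(* The low-order point-value scheme divides by hx and hy. *)
Definition hx (R : realType) (m : mesh R) (s : point) : R :=
  match s with
  | Corner i _ | VFace i _ => (dx m i + dx m (i + 1)) / 2
  | HFace i _ => dx m i
  end.
Definition hy (R : realType) (m : mesh R) (s : point) : R :=
  match s with
  | Corner _ j | HFace _ j => (dy m j + dy m (j + 1)) / 2
  | VFace _ j => dy m j
  end.

(* Cells and points of the mesh extended by k ghost layers; k = 0 gives the
   cells and points of the mesh itself. *)
Definition cell_in (R : realType) (m : mesh R) (k : nat) (i j : int) : bool :=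
  (1 - k%:Z <= i <= (N1 m)%:Z + k%:Z) && (1 - k%:Z <= j <= (N2 m)%:Z + k%:Z).
Definition point_in (R : realType) (m : mesh R) (k : nat) (s : point) : bool :=
  match s with
  | Corner i j => (- k%:Z <= i <= (N1 m)%:Z + k%:Z)
                  && (- k%:Z <= j <= (N2 m)%:Z + k%:Z)
  | VFace i j => (- k%:Z <= i <= (N1 m)%:Z + k%:Z)
                 && (1 - k%:Z <= j <= (N2 m)%:Z + k%:Z)
  | HFace i j => (1 - k%:Z <= i <= (N1 m)%:Z + k%:Z)
                 && (- k%:Z <= j <= (N2 m)%:Z + k%:Z)
  end.

Record dofs (V : Type) := Dofs {
  avg : int -> int -> V;
  pt : point -> V }.

Definition all_in (R : realType) (V : Type) (m : mesh R) (k : nat)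
    (G : V -> Prop) (U : dofs V) : Prop :=
  (forall i j, cell_in m k i j -> G (avg U i j)) /\
  (forall s, point_in m k s -> G (pt U s)).

Definition agree_on_mesh (R : realType) (V : Type) (m : mesh R)
    (U W : dofs V) : Prop :=
  (forall i j, cell_in m 0 i j -> avg U i j = avg W i j) /\
  (forall s, point_in m 0 s -> pt U s = pt W s).

(* a, a + 1, ..., a + n - 1 *)
Definition irange (a : int) (n : nat) : seq int :=
  [seq a + k%:Z | k <- iota 0 n].

(* All degrees of freedom, ghost values included. *)
Definition all_dofs (R : realType) (V : Type) (m : mesh R) (U : dofs V) :
    seq V :=
  let ci := irange (1 - (ng m)%:Z) (N1 m + (ng m).*2) in
  let cj := irange (1 - (ng m)%:Z) (N2 m + (ng m).*2) in
  let fi := irange (- (ng m)%:Z) (N1 m + (ng m).*2).+1 in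
  let fj := irange (- (ng m)%:Z) (N2 m + (ng m).*2).+1 in
  [seq avg U i j | i <- ci, j <- cj] ++
  [seq pt U (Corner i j) | i <- fi, j <- fj] ++
  [seq pt U (VFace i j) | i <- fi, j <- cj] ++
  [seq pt U (HFace i j) | i <- ci, j <- fj].

(* A conservation law: the fluxes F_1, F_2 and the spectral radii of their
   Jacobians. *)
Record law (R : realType) (V : Type) := Law {
  flux1 : V -> V;
  flux2 : V -> V;
  rad1 : V -> R;
  rad2 : V -> R }.

(* The high-order part of the method.  FH1 U i j is \hat F^H_{i+1/2,j} and
   FH2 U i j is \hat F^H_{i,j+1/2}.  The face quadrature and the point-value
   update are unspecified functions of the degrees of freedom; Simpson's rule
   is FH1 U i j = (F_1(U_{i+1/2,j-1/2}) + 4 F_1(U_{i+1/2,j})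
   + F_1(U_{i+1/2,j+1/2})) / 6, and residual U s is R_s. *)
Record high_order (V : Type) := HighOrder {
  FH1 : dofs V -> int -> int -> V;
  FH2 : dofs V -> int -> int -> V;
  residual : dofs V -> point -> V }.

Section LocalLaxFriedrichs.
Variables (R : realType) (V : lmodType R).
Implicit Types (F : V -> V) (r : V -> R).

Definition llf_speed r (v w : V) : R := Num.max (r v) (r w).

Definition llf_flux F r (v w : V) : V :=
  2^-1 *: (F v + F w) - (2^-1 * llf_speed r v w) *: (w - v).

(* The intermediate state written \tilde U. *)
Definition llf_state F r (v w : V) : V :=
  2^-1 *: (v + w) + (2 * llf_speed r v w)^-1 *: (F v - F w).

End LocalLaxFriedrichs.

Section Scheme.
Variables (R : realType) (V : lmodType R) (m : mesh R) (L : law R V).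
Implicit Types (U : dofs V) (i j : int) (dt : R).

(* Index (i,j) stands for the face (i+1/2,j) in the definitions with suffix 1,
   and for the face (i,j+1/2) in those with suffix 2. *)
Definition alpha1 U i j : R := llf_speed (rad1 L) (avg U i j) (avg U (i + 1) j).
Definition alpha2 U i j : R := llf_speed (rad2 L) (avg U i j) (avg U i (j + 1)).
Definition FL1 U i j : V :=
  llf_flux (flux1 L) (rad1 L) (avg U i j) (avg U (i + 1) j).
Definition FL2 U i j : V :=
  llf_flux (flux2 L) (rad2 L) (avg U i j) (avg U i (j + 1)).
Definition tilde1 U i j : V :=
  llf_state (flux1 L) (rad1 L) (avg U i j) (avg U (i + 1) j).
Definition tilde2 U i j : V :=
  llf_state (flux2 L) (rad2 L) (avg U i j) (avg U i (j + 1)).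

Definition cell_update (F1 F2 : int -> int -> V) dt U i j : V :=
  avg U i j - (dt / dx m i) *: (F1 i j - F1 (i - 1) j)
            - (dt / dy m j) *: (F2 i j - F2 i (j - 1)).

Definition point_high (H : high_order V) dt U (s : point) : V :=
  pt U s - dt *: residual H U s.

Definition point_low dt U (s : point) : V :=
  pt U s
  - (dt / hx m s) *: (llf_flux (flux1 L) (rad1 L) (pt U s) (pt U (east s))
                      - llf_flux (flux1 L) (rad1 L) (pt U (west s)) (pt U s))
  - (dt / hy m s) *: (llf_flux (flux2 L) (rad2 L) (pt U s) (pt U (north s))
                      - llf_flux (flux2 L) (rad2 L) (pt U (south s)) (pt U s)).

Definition T1 dt U : Prop := forall i j, cell_in m 0 i j ->
  dt <= 2^-1 * Num.min (dx m i / (alpha1 U (i - 1) j + alpha1 U i j))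
                       (dy m j / (alpha2 U i (j - 1) + alpha2 U i j)).

Definition T2 dt U : Prop := forall s, point_in m 0 s ->
  dt <= 2^-1 * Num.min
    (hx m s / (llf_speed (rad1 L) (pt U (west s)) (pt U s)
               + llf_speed (rad1 L) (pt U s) (pt U (east s))))
    (hy m s / (llf_speed (rad2 L) (pt U (south s)) (pt U s)
               + llf_speed (rad2 L) (pt U s) (pt U (north s)))).

(* Besides the faces of the mesh cells, the limiting of a face uses the faces
   of the two cells adjacent to it, one of which may be a ghost cell. *)
Definition near_mesh i j : bool :=
  [|| cell_in m 0 i j, cell_in m 0 (i - 1) j, cell_in m 0 (i + 1) j,
      cell_in m 0 i (j - 1) | cell_in m 0 i (j + 1)].

Definition positive_viscosities U : Prop :=
  (forall i j, near_mesh i j ->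
    [/\ 0 < alpha1 U (i - 1) j, 0 < alpha1 U i j,
        0 < alpha2 U i (j - 1) & 0 < alpha2 U i j]) /\
  (forall s, point_in m 0 s ->
    [/\ 0 < llf_speed (rad1 L) (pt U (west s)) (pt U s),
        0 < llf_speed (rad1 L) (pt U s) (pt U (east s)),
        0 < llf_speed (rad2 L) (pt U (south s)) (pt U s) &
        0 < llf_speed (rad2 L) (pt U s) (pt U (north s))]).

Definition stage_ok dt U : Prop :=
  [/\ positive_viscosities U, T1 dt U & T2 dt U].

End Scheme.

Section TimeStepping.
Variables (R : realType) (V : lmodType R) (m : mesh R).
Variables (S : R -> dofs V -> dofs V) (bc : nat -> nat -> dofs V -> dofs V).
Variables (dt : nat -> R) (U0 : dofs V).

Definition comb_dofs (a b : R) (U W : dofs V) : dofs V :=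
  Dofs (fun i j => a *: avg U i j + b *: avg W i j)
       (fun s => a *: pt U s + b *: pt W s).

(* bc n k fills in the ghost values in the k-th stage (k = 0, 1, 2) of the step
   from level n to level n + 1, from the values on the mesh (which it keeps);
   the ghost values belong to G as soon as the mesh values do. *)
Definition valid_bc (G : V -> Prop) : Prop := forall n k U,
  agree_on_mesh m (bc n k U) U /\
  (all_in m 0 G U -> all_in m (ng m) G (bc n k U)).

(* Inputs of the three forward-Euler steps of the SSP-RK3 step from level n,
   U being the degrees of freedom at level n. *)
Definition rk_in1 n U : dofs V := bc n 0 U.
Definition rk_in2 n U : dofs V := bc n 1 (S (dt n) (rk_in1 n U)).
Definition rk_in3 n U : dofs V :=
  bc n 2 (comb_dofs (3 / 4) (1 / 4) U (S (dt n) (rk_in2 n U))).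
Definition rk_step n U : dofs V :=
  comb_dofs (1 / 3) (2 / 3) U (S (dt n) (rk_in3 n U)).

Fixpoint level (n : nat) : dofs V :=
  if n is n'.+1 then rk_step n' (level n') else U0.

Definition stages_ok (L : law R V) : Prop := forall n,
  [/\ stage_ok m L (dt n) (rk_in1 n (level n)),
      stage_ok m L (dt n) (rk_in2 n (level n)) &
      stage_ok m L (dt n) (rk_in3 n (level n))].

End TimeStepping.

(* Which set N the bounds of the scalar limiters are taken over. *)
Inductive bounds_kind := GlobalBounds | LocalBounds.

Section Scalar.
Variables (R : realType) (f1 f2 : R -> R).

(* The spectral radius of the 1 x 1 Jacobian f'(u) is |f'(u)|. *)
Definition scalar_law : law R R :=
  Law f1 f2 (fun u => `|derive1 f1 u|) (fun u => `|derive1 f2 u|).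

Definition scalar_G (m0 M0 : R) (u : R) : Prop := m0 <= u <= M0.

Definition domain (m : mesh R) (q : R * R) : Prop :=
  (xf m 0 <= q.1 <= xf m (N1 m)%:Z) /\ (yf m 0 <= q.2 <= yf m (N2 m)%:Z).

Definition is_min (D : R * R -> Prop) (u0 : R * R -> R) (a : R) : Prop :=
  (forall q, D q -> a <= u0 q) /\ (exists2 q, D q & u0 q = a).
Definition is_max (D : R * R -> Prop) (u0 : R * R -> R) (b : R) : Prop :=
  (forall q, D q -> u0 q <= b) /\ (exists2 q, D q & u0 q = b).

(* The wave speed r at every state between v and w is bounded by the LLF
   viscosity coefficient max(r v, r w).  For r = |f'| this holds in particular
   whenever f is convex or concave; without it the LLF scheme itself violates
   the maximum principle. *)
Definition llf_speed_dominates (G : R -> Prop) (r : R -> R) : Prop :=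
  forall v w u, G v -> G w -> Num.min v w <= u <= Num.max v w ->
    r u <= llf_speed r v w.

Variables (m : mesh R) (H : high_order R) (cellN ptN : bounds_kind).
Implicit Types (U : dofs R) (i j : int) (dt : R).

Definition cell_nbhd U i j : seq R :=
  match cellN with
  | GlobalBounds => all_dofs m U
  | LocalBounds =>
      [:: tilde1 scalar_law U i j; tilde1 scalar_law U (i - 1) j;
          tilde2 scalar_law U i j; tilde2 scalar_law U i (j - 1);
          avg U (i + 1) j; avg U (i - 1) j; avg U i (j + 1); avg U i (j - 1)]
  end.
(* In the global case the base point is one of the degrees of freedom already
   in the list. *)
Definition cell_base U i j : R :=
  match cellN with GlobalBounds => avg U 1 1 | LocalBounds => avg U i j end.
Definition cell_min U i j : R := minl (cell_base U i j) (cell_nbhd U i j).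
Definition cell_max U i j : R := maxl (cell_base U i j) (cell_nbhd U i j).

(* Limited flux at a face whose left (or lower) cell has bounds mnl, mxl and
   whose right (or upper) cell has bounds mnr, mxr. *)
Definition scalar_flux_lim (alpha ut fL fH mnl mxl mnr mxr : R) : R :=
  let d := fH - fL in
  fL + (if 0 <= d then Num.min d (alpha * Num.min (ut - mnl) (mxr - ut))
        else Num.max d (alpha * Num.max (mnr - ut) (ut - mxl))).

Definition scalar_lim1 U i j : R :=
  scalar_flux_lim (alpha1 scalar_law U i j) (tilde1 scalar_law U i j)
    (FL1 scalar_law U i j) (FH1 H U i j)
    (cell_min U i j) (cell_max U i j)
    (cell_min U (i + 1) j) (cell_max U (i + 1) j).
Definition scalar_lim2 U i j : R :=
  scalar_flux_lim (alpha2 scalar_law U i j) (tilde2 scalar_law U i j)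
    (FL2 scalar_law U i j) (FH2 H U i j)
    (cell_min U i j) (cell_max U i j)
    (cell_min U i (j + 1)) (cell_max U i (j + 1)).

Definition point_nbhd U (s : point) : seq R :=
  match ptN with
  | GlobalBounds => all_dofs m U
  | LocalBounds =>
      [:: pt U (east s); pt U (west s); pt U (north s); pt U (south s)]
  end.
Definition point_base U (s : point) : R :=
  match ptN with GlobalBounds => avg U 1 1 | LocalBounds => pt U s end.
Definition point_min U s : R := minl (point_base U s) (point_nbhd U s).
Definition point_max U s : R := maxl (point_base U s) (point_nbhd U s).

Definition scalar_point_theta (uL uH mn mx : R) : R :=
  if uH == uL then 1
  else Num.min 1 (Num.min `|(uL - mn) / (uL - uH)| `|(mx - uL) / (uH - uL)|).

Definition scalar_point_update dt U (s : point) : R :=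
  let uL := point_low m scalar_law dt U s in
  let uH := point_high H dt U s in
  let theta := scalar_point_theta uL uH (point_min U s) (point_max U s) in
  theta * uH + (1 - theta) * uL.

Definition scalar_step dt U : dofs R :=
  Dofs (cell_update m (scalar_lim1 U) (scalar_lim2 U) dt U)
       (scalar_point_update dt U).

End Scalar.

(* Spectral radius of a real square matrix: the largest modulus of its complex
   eigenvalues. *)
Definition spectral_radius (R : realType) (n : nat) (A : 'M[R]_n) : R :=
  sup [set Normc.normc z | z in
        [set z : R[i] | eigenvalue (map_mx (real_complex R) A) z]]%classic.

Section Euler.
Variables (R : realType) (gamma : R).

(* State vectors are (rho, rho v_1, rho v_2, E). *)
Definition state4 (a b c d : R) : 'rV[R]_4 := \row_(k < 4) [:: a; b; c; d]`_k.
Definition rho (U : 'rV[R]_4) : R := U 0 0.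
Definition mom1 (U : 'rV[R]_4) : R := U 0 1.
Definition mom2 (U : 'rV[R]_4) : R := U 0 2.
Definition ener (U : 'rV[R]_4) : R := U 0 3.
Definition vel1 (U : 'rV[R]_4) : R := mom1 U / rho U.
Definition vel2 (U : 'rV[R]_4) : R := mom2 U / rho U.

Definition pressure (U : 'rV[R]_4) : R :=
  (gamma - 1) * (ener U - (mom1 U ^+ 2 + mom2 U ^+ 2) / (2 * rho U)).

Definition euler_flux1 (U : 'rV[R]_4) : 'rV[R]_4 :=
  state4 (rho U * vel1 U)
         (rho U * vel1 U ^+ 2 + pressure U)
         (rho U * vel1 U * vel2 U)
         ((ener U + pressure U) * vel1 U).
Definition euler_flux2 (U : 'rV[R]_4) : 'rV[R]_4 :=
  state4 (rho U * vel2 U)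
         (rho U * vel1 U * vel2 U)
         (rho U * vel2 U ^+ 2 + pressure U)
         ((ener U + pressure U) * vel2 U).

(* The library's jacobian acts on row vectors, i.e. it is the transpose of the
   usual Jacobian matrix; the spectrum is the same. *)
Definition euler_law : law R 'rV[R]_4 :=
  Law euler_flux1 euler_flux2
      (fun U => spectral_radius (jacobian euler_flux1 U))
      (fun U => spectral_radius (jacobian euler_flux2 U)).

Definition euler_G (U : 'rV[R]_4) : Prop := 0 < rho U /\ 0 < pressure U.

Variables (m : mesh R) (H : high_order 'rV[R]_4).
Implicit Types (U : dofs 'rV[R]_4) (W : 'rV[R]_4) (i j : int) (dt : R).

Definition eps0 : R := 10 ^- 13.
Definition eps_rho U : R :=
  minl (rho (avg U 1 1)) [seq rho W | W <- all_dofs m U].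
Definition eps_p U : R :=
  minl (pressure (avg U 1 1)) [seq pressure W | W <- all_dofs m U].

Definition adjacent_tildes U i j : seq 'rV[R]_4 :=
  [:: tilde1 euler_law U i j; tilde1 euler_law U (i - 1) j;
      tilde2 euler_law U i j; tilde2 euler_law U i (j - 1)].
Definition cell_eps_rho U i j : R :=
  minl eps0 (eps_rho U :: [seq rho W | W <- adjacent_tildes U i j]).
Definition cell_eps_p U i j : R :=
  minl eps0 (eps_p U :: [seq pressure W | W <- adjacent_tildes U i j]).

Definition euler_flux_lim (alpha : R) (Ut FL FH : 'rV[R]_4) (er ep : R) :
    'rV[R]_4 :=
  let d := rho (FH - FL) in
  let dlim := if 0 <= d then Num.min d (alpha * (rho Ut - er))
              else Num.max d (alpha * (er - rho Ut)) in
  let Fstar := state4 (rho FL + dlim) (mom1 FH) (mom2 FH) (ener FH) in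
  let D := Fstar - FL in
  let et := ep / (gamma - 1) in
  let A := (mom1 D ^+ 2 + mom2 D ^+ 2) / 2 - rho D * ener D in
  let B := alpha * (rho D * ener Ut + rho Ut * ener D
                    - (mom1 D * mom1 Ut + mom2 D * mom2 Ut) - et * rho D) in
  let C := alpha ^+ 2 * (rho Ut * ener Ut
                         - (mom1 Ut ^+ 2 + mom2 Ut ^+ 2) / 2 - et * rho Ut) in
  let den := Num.max 0 A + `|B| in
  let theta := if den == 0 then 1 else Num.min 1 (C / den) in
  FL + theta *: D.

Definition euler_lim1 U i j : 'rV[R]_4 :=
  euler_flux_lim (alpha1 euler_law U i j) (tilde1 euler_law U i j)
    (FL1 euler_law U i j) (FH1 H U i j)
    (Num.min (cell_eps_rho U i j) (cell_eps_rho U (i + 1) j))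
    (Num.min (cell_eps_p U i j) (cell_eps_p U (i + 1) j)).
Definition euler_lim2 U i j : 'rV[R]_4 :=
  euler_flux_lim (alpha2 euler_law U i j) (tilde2 euler_law U i j)
    (FL2 euler_law U i j) (FH2 H U i j)
    (Num.min (cell_eps_rho U i j) (cell_eps_rho U i (j + 1)))
    (Num.min (cell_eps_p U i j) (cell_eps_p U i (j + 1))).

Definition euler_point_update dt U (s : point) : 'rV[R]_4 :=
  let UL := point_low m euler_law dt U s in
  let UH := point_high H dt U s in
  let er := minl eps0 [:: eps_rho U; rho UL] in
  let ep := minl eps0 [:: eps_p U; pressure UL] in
  let theta1 := if rho UH < er then (rho UL - er) / (rho UL - rho UH) else 1 in
  let Ustar := state4 (theta1 * rho UH + (1 - theta1) * rho UL)
                      (mom1 UH) (mom2 UH) (ener UH) in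
  let theta2 := if pressure Ustar < ep
                then (pressure UL - ep) / (pressure UL - pressure Ustar)
                else 1 in
  theta2 *: Ustar + (1 - theta2) *: UL.

Definition euler_step dt U : dofs 'rV[R]_4 :=
  Dofs (cell_update m (euler_lim1 U) (euler_lim2 U) dt U)
       (euler_point_update dt U).

End Euler.

(* Main.v *)
Require Import Defs.
From HB Require Import structures.
From mathcomp Require Import all_boot all_order all_algebra.
From mathcomp Require Import complex.
From mathcomp Require Import all_classical all_reals all_analysis.
From mathcomp Require Import ring lra zify.

Set Implicit Arguments.
Unset Strict Implicit.
Unset Printing Implicit Defensive.

Import Order.TTheory GRing.Theory Num.Theory.
Import numFieldNormedType.Exports.
Local Open Scope ring_scope.

(* Convexity. By (T1) and (T2) each cell average and each low-order point value
   is updated to a convex combination of the old value and of intermediate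
   states \tilde U -+ (F^Lim - F^L) / alpha, one per adjacent face.  In the
   scalar case \tilde U lies between the two neighbouring states by the mean
   value theorem.  In the Euler case \tilde U is the half sum of V + F(V)/alpha
   and W - F(W)/alpha, which are admissible as soon as alpha >= |v| + c; this
   holds because v + c and v - c are eigenvalues of the Jacobian.  The limiters
   are tuned so that adding -+ (F^Lim - F^L) / alpha does not leave the
   admissible set, and the SSP-RK3 stages are again convex combinations. *)

(** The limiters enter only through [face_admissible], a property of one face: the same limited flux
    must suit both cells that share the face, so the two signs of the correction are controlled
    together, and the convexity argument needs nothing else about how the flux was limited. For
    Euler the viscosity is not an explicit formula but a supremum over complex eigenvalues of a
    Jacobian; the argument needs only a lower bound, so exhibiting acoustic eigenvectors replaces
    computing the spectrum. Strict positivity survives limiters that only enforce weak inequalities,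
    because the thresholds on density and pressure are minima of finitely many positive numbers.
    Limiting at a boundary face involves a cell of the first ghost layer and that cell's own
    neighbours, which is where the second ghost layer is used. *)

(** * Eigenvalues, spectral radius and differentials *)

Lemma normc_real (R : realType) (x : R) : Normc.normc (real_complex R x) = `|x|.
Proof. by rewrite /= expr0n /= addr0 sqrtr_sqr. Qed.

(** A supremum dominates its set only if the set is bounded. Over [R[i]] the characteristic
    polynomial splits, and the sum of the moduli of its roots bounds every eigenvalue. *)
Lemma spectral_radius_ge (R : realType) n (A : 'M[R]_n) (a : R) :
  eigenvalue A a -> `|a| <= spectral_radius A.
Proof.
move=> Aa; apply: ub_le_sup; last first.
  by exists (real_complex R a); rewrite ?normc_real //= eigenvalue_map.
pose p := char_poly (map_mx (real_complex R) A).
have [r Dp] := closed_field_poly_normal p.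
exists (\sum_(z <- r) Normc.normc z) => _ [z /= zA <-].
have zr : z \in r.
  move: zA; rewrite eigenvalue_root_char -/p Dp (monicP (char_poly_monic _)).
  by rewrite scale1r root_prod_XsubC.
rewrite (big_rem z zr) /= lerDl sumr_ge0 // => -[x y] _.
exact: sqrtr_ge0.
Qed.

Lemma is_diff_coord (R : realType) m n (M : 'M[R]_(m, n)) i j :
  is_diff M (fun N : 'M[R]_(m, n) => N i j : R) (fun N => N i j).
Proof.
apply: DiffDef; first exact: differentiable_coord.
have lin : linear (fun N : 'M[R]_(m, n) => N i j : R).
  by move=> a N N'; rewrite !mxE.
pose f : {linear 'M[R]_(m, n) -> R} :=
  HB.pack (fun N : 'M[R]_(m, n) => N i j) (GRing.isLinear.Build _ _ _ _ _ lin).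
by rewrite (diff_lin (f := f)) //; exact: coord_continuous.
Qed.

Lemma is_diffV (R : realType) (V : normedModType R) (f df : V -> R) x :
  f x != 0 -> is_diff x f df ->
  is_diff x (fun y => (f y)^-1) (fun h => - (f x) ^- 2 * df h).
Proof.
move=> fx0 fdf; apply: DiffDef; first exact: differentiableV.
by rewrite diffV // diff_val.
Qed.

(** The derivative of [F] along [W] is the row [W] times the Jacobian, so an eigenvector of the
    differential is a row eigenvector. Differentials are given by component, which reduces the
    fluxes to the calculus of real-valued functions. *)
Lemma eigenvalue_jacobian (R : realType) n (F : 'rV[R]_n.+1 -> 'rV[R]_n.+1)
    (dF : 'rV[R]_n.+1 -> 'rV[R]_n.+1) (U W : 'rV[R]_n.+1) (l : R) :
  (forall k, is_diff U (fun X => F X 0 k) (fun X => dF X 0 k)) ->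
  dF W = l *: W -> W != 0 -> eigenvalue (jacobian F U) l.
Proof.
move=> FdF dFW W0; apply/eigenvalueP; exists W => //.
have FE : F = \sum_(k < n.+1) (fun X => F X 0 k *: delta_mx 0 k).
  apply/funext => X; rewrite fct_sumE {1}(row_sum_delta (F X)); exact: eq_bigr.
have dif : differentiable F U.
  rewrite FE; apply: differentiable_sum => k; apply: differentiableZl.
  by have := FdF k; case.
rewrite -deriveEjacobian // derive_mx; last exact: diff_derivable.
rewrite -dFW; apply/rowP => k; rewrite mxE.
have [d1 d2] := FdF k.
by rewrite deriveE // d2.
Qed.

(** * Components of Euler state vectors *)

Section EulerState.
Variable R : realType.
Implicit Types (U W : 'rV[R]_4).

Lemma eq_state U W : rho U = rho W -> mom1 U = mom1 W -> mom2 U = mom2 W ->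
  ener U = ener W -> U = W.
Proof.
move=> e0 e1 e2 e3; apply/rowP => -[[|[|[|[|//]]]] i].
- by rewrite (_ : Ordinal i = 0) //; apply/val_inj.
- by rewrite (_ : Ordinal i = 1) //; apply/val_inj.
- by rewrite (_ : Ordinal i = 2) //; apply/val_inj.
- by rewrite (_ : Ordinal i = 3) //; apply/val_inj.
Qed.

Lemma rhoE : (forall U W, rho (U + W) = rho U + rho W) *
  (forall a U, rho (a *: U) = a * rho U) * (forall U, rho (- U) = - rho U) *
  (forall a b c d : R, rho (state4 a b c d) = a).
Proof. by do !split=> *; rewrite /rho mxE. Qed.

Lemma mom1E : (forall U W, mom1 (U + W) = mom1 U + mom1 W) *
  (forall a U, mom1 (a *: U) = a * mom1 U) * (forall U, mom1 (- U) = - mom1 U) *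
  (forall a b c d : R, mom1 (state4 a b c d) = b).
Proof. by do !split=> *; rewrite /mom1 mxE. Qed.

Lemma mom2E : (forall U W, mom2 (U + W) = mom2 U + mom2 W) *
  (forall a U, mom2 (a *: U) = a * mom2 U) * (forall U, mom2 (- U) = - mom2 U) *
  (forall a b c d : R, mom2 (state4 a b c d) = c).
Proof. by do !split=> *; rewrite /mom2 mxE. Qed.

Lemma enerE : (forall U W, ener (U + W) = ener U + ener W) *
  (forall a U, ener (a *: U) = a * ener U) * (forall U, ener (- U) = - ener U) *
  (forall a b c d : R, ener (state4 a b c d) = d).
Proof. by do !split=> *; rewrite /ener mxE. Qed.

Definition stateE := (rhoE, mom1E, mom2E, enerE).

End EulerState.

(** * Spectral radii of the Euler Jacobians *)

Section EulerJacobian.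
Variables (R : realType) (gamma : R).
Implicit Types (U W : 'rV[R]_4).

(** Differentials at [U] in the direction [W]. Those of velocity and pressure stay separate, so that
    each is evaluated once on an eigenvector. *)
Definition dvel1 U W := (mom1 W - vel1 U * rho W) / rho U.
Definition dvel2 U W := (mom2 W - vel2 U * rho W) / rho U.
Definition dpressure U W := (gamma - 1) *
  (ener W - (vel1 U * mom1 W + vel2 U * mom2 W)
   + (vel1 U ^+ 2 + vel2 U ^+ 2) / 2 * rho W).

Definition dflux1 U W := state4
  (mom1 W)
  (vel1 U ^+ 2 * rho W + 2 * (rho U * vel1 U) * dvel1 U W + dpressure U W)
  (vel2 U * mom1 W + rho U * vel1 U * dvel2 U W)
  ((ener W + dpressure U W) * vel1 U + (ener U + pressure gamma U) * dvel1 U W).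
Definition dflux2 U W := state4
  (mom2 W)
  (vel1 U * mom2 W + rho U * vel2 U * dvel1 U W)
  (vel2 U ^+ 2 * rho W + 2 * (rho U * vel2 U) * dvel2 U W + dpressure U W)
  ((ener W + dpressure U W) * vel2 U + (ener U + pressure gamma U) * dvel2 U W).

Variable U : 'rV[R]_4.
Hypothesis rU : rho U != 0.

Let drho : is_diff U (@rho R) (@rho R) := is_diff_coord U 0 0.
Let dmom1 : is_diff U (@mom1 R) (@mom1 R) := is_diff_coord U 0 1.
Let dmom2 : is_diff U (@mom2 R) (@mom2 R) := is_diff_coord U 0 2.
Let dener : is_diff U (@ener R) (@ener R) := is_diff_coord U 0 3.

Lemma is_diff_vel1 : is_diff U (@vel1 R) (dvel1 U).
Proof.
apply: is_diff_eq; first exact: (is_diffM dmom1 (is_diffV rU drho)).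
apply/funext => W; rewrite /dvel1 /vel1 !fctE /= /GRing.scale /=; field.
exact: rU.
Qed.

Lemma is_diff_vel2 : is_diff U (@vel2 R) (dvel2 U).
Proof.
apply: is_diff_eq; first exact: (is_diffM dmom2 (is_diffV rU drho)).
apply/funext => W; rewrite /dvel2 /vel2 !fctE /= /GRing.scale /=; field.
exact: rU.
Qed.

Lemma is_diff_pressure : is_diff U (pressure gamma) (dpressure U).
Proof.
have r2U : (2 *: @rho R) U != 0.
  by rewrite fctE mulf_neq0 // pnatr_eq0.
have -> : pressure gamma = (gamma - 1) *: (@ener R
    - (@mom1 R ^+ 2 + @mom2 R ^+ 2) * (fun X => ((2 *: @rho R) X)^-1)).
  by apply/funext => X; rewrite /pressure !fctE.
have dr2 := is_diffV r2U (is_diffZ 2 drho).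
apply: is_diff_eq; first exact: (is_diffZ _
  (is_diffB dener
    (is_diffM (is_diffD (is_diffX 1 dmom1) (is_diffX 1 dmom2)) dr2))).
apply/funext => W; rewrite /dpressure /vel1 /vel2 !fctE /GRing.scale /=.
field.
exact: rU.
Qed.

Lemma is_diff_state4 (a b c d da db dc dd : 'rV[R]_4 -> R) k :
  is_diff U a da -> is_diff U b db -> is_diff U c dc -> is_diff U d dd ->
  is_diff U (fun X => state4 (a X) (b X) (c X) (d X) 0 k)
            (fun W => state4 (da W) (db W) (dc W) (dd W) 0 k).
Proof.
have E (a' b' c' d' : 'rV[R]_4 -> R) :
    (fun X => state4 (a' X) (b' X) (c' X) (d' X) 0 k)
    = [:: a'; b'; c'; d']`_k.
  by apply/funext => X; rewrite mxE; case: k => -[|[|[|[|]]]].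
by rewrite !E; case: k {E} => -[|[|[|[|]]]].
Qed.

Lemma is_diff_flux1 k :
  is_diff U (fun X => euler_flux1 gamma X 0 k) (fun W => dflux1 U W 0 k).
Proof.
have dv1 := is_diff_vel1; have dv2 := is_diff_vel2.
have dp := is_diff_pressure.
apply: is_diff_state4.
- apply: is_diff_eq; first exact: (is_diffM drho dv1).
  apply/funext => W; rewrite !fctE /dvel1 /vel1 /GRing.scale /=.
  field; exact: rU.
- apply: is_diff_eq; first
    exact: (is_diffD (is_diffM drho (is_diffX 1 dv1)) dp).
  apply/funext => W; rewrite !fctE /GRing.scale /=; ring.
- apply: is_diff_eq; first exact: (is_diffM (is_diffM drho dv1) dv2).
  apply/funext => W; rewrite !fctE /GRing.scale /dvel1 /dvel2 /vel1 /vel2 /=.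
  field; exact: rU.
- apply: is_diff_eq; first exact: (is_diffM (is_diffD dener dp) dv1).
  apply/funext => W; rewrite !fctE /GRing.scale /=; ring.
Qed.

Lemma is_diff_flux2 k :
  is_diff U (fun X => euler_flux2 gamma X 0 k) (fun W => dflux2 U W 0 k).
Proof.
have dv1 := is_diff_vel1; have dv2 := is_diff_vel2.
have dp := is_diff_pressure.
apply: is_diff_state4.
- apply: is_diff_eq; first exact: (is_diffM drho dv2).
  apply/funext => W; rewrite !fctE /dvel2 /vel2 /GRing.scale /=.
  field; exact: rU.
- apply: is_diff_eq; first exact: (is_diffM (is_diffM drho dv1) dv2).
  apply/funext => W; rewrite !fctE /GRing.scale /dvel1 /dvel2 /vel1 /vel2 /=.
  field; exact: rU.
- apply: is_diff_eq; first
    exact: (is_diffD (is_diffM drho (is_diffX 1 dv2)) dp).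
  apply/funext => W; rewrite !fctE /GRing.scale /=; ring.
- apply: is_diff_eq; first exact: (is_diffM (is_diffD dener dp) dv2).
  apply/funext => W; rewrite !fctE /GRing.scale /=; ring.
Qed.


(* [W] is the classical right eigenvector (1, v1 + c, v2, h + v1 c) of an
   acoustic wave, [h] being the specific total enthalpy. *)
Lemma eigenvalue_flux1 c : c ^+ 2 = gamma * pressure gamma U / rho U ->
  eigenvalue (jacobian (euler_flux1 gamma) U) (vel1 U + c).
Proof.
move=> c2.
pose h := (ener U + pressure gamma U) / rho U.
pose W := state4 1 (vel1 U + c) (vel2 U) (h + vel1 U * c).
(* Along the acoustic wave the density changes by 1, the normal velocity by c / rho, the transverse
   velocity not at all and the pressure by c^2. *)
have dv1 : dvel1 U W = c / rho U by rewrite /dvel1 !stateE; field; exact: rU.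
have dv2 : dvel2 U W = 0 by rewrite /dvel2 !stateE; field; exact: rU.
have dp : dpressure U W = c ^+ 2.
  rewrite /dpressure !stateE c2 /h /pressure /vel1 /vel2; field.
  exact: rU.
apply: (eigenvalue_jacobian is_diff_flux1 (W := W)); last first.
  have W_1 : rho W = 1 by rewrite stateE.
  by apply: contra_neq (oner_neq0 R) => W_0; rewrite -W_1 W_0 /rho mxE.
rewrite /dflux1 dv1 dv2 dp; apply: eq_state; rewrite !stateE /h; field.
all: by rewrite ?rU.
Qed.

Lemma eigenvalue_flux2 c : c ^+ 2 = gamma * pressure gamma U / rho U ->
  eigenvalue (jacobian (euler_flux2 gamma) U) (vel2 U + c).
Proof.
move=> c2.
pose h := (ener U + pressure gamma U) / rho U.
pose W := state4 1 (vel1 U) (vel2 U + c) (h + vel2 U * c).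
have dv1 : dvel1 U W = 0 by rewrite /dvel1 !stateE; field; exact: rU.
have dv2 : dvel2 U W = c / rho U by rewrite /dvel2 !stateE; field; exact: rU.
have dp : dpressure U W = c ^+ 2.
  rewrite /dpressure !stateE c2 /h /pressure /vel1 /vel2; field.
  exact: rU.
apply: (eigenvalue_jacobian is_diff_flux2 (W := W)); last first.
  have W_1 : rho W = 1 by rewrite stateE.
  by apply: contra_neq (oner_neq0 R) => W_0; rewrite -W_1 W_0 /rho mxE.
rewrite /dflux2 dv1 dv2 dp; apply: eq_state; rewrite !stateE /h; field.
all: by rewrite ?rU.
Qed.

End EulerJacobian.

(** * Admissible Euler states *)

Section EulerAdmissible.
Variables (R : realType) (gamma : R).
Hypothesis g1 : 1 < gamma.
Implicit Types (U W : 'rV[R]_4).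
Notation G := (euler_G gamma).
Notation p := (pressure gamma).

Let g0 : 0 < gamma - 1. Proof. by rewrite subr_gt0. Qed.

(** Clearing the denominator makes positive pressure a quadratic inequality, the form that [A], [B]
    and [C] of the flux limiter control. *)
Lemma euler_GP U :
  G U <-> 0 < rho U /\ mom1 U ^+ 2 + mom2 U ^+ 2 < 2 * rho U * ener U.
Proof.
rewrite /euler_G /pressure; split=> -[r0]; rewrite pmulr_rgt0 // subr_gt0;
  by rewrite ltr_pdivrMr ?mulr_gt0 // [ener U * _]mulrC.
Qed.

(** The gap is explicit: up to the factor [gamma - 1] it is the kinetic energy lost when the two
    velocities are mixed, a nonnegative multiple of the squared velocity difference. *)
Lemma pressure_concave (a b : R) U W : 0 <= a -> 0 <= b ->
  0 < rho U -> 0 < rho W -> 0 < a * rho U + b * rho W ->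
  a * p U + b * p W <= p (a *: U + b *: W).
Proof.
move=> a0 b0 rU rW rUW; rewrite -subr_ge0 /pressure !stateE.
set d := (X in 0 <= X).
suff -> : d = (gamma - 1) * (a * b * ((rho W * mom1 U - rho U * mom1 W) ^+ 2
    + (rho W * mom2 U - rho U * mom2 W) ^+ 2)
    / (2 * rho U * rho W * (a * rho U + b * rho W))).
  apply: mulr_ge0; first exact: ltW.
  apply: mulr_ge0; last by rewrite invr_ge0 ltW // !mulr_gt0.
  by rewrite mulr_ge0 ?addr_ge0 ?sqr_ge0 // mulr_ge0.
by rewrite /d; field; rewrite !gt_eqF.
Qed.

Lemma euler_G_convex (a b : R) U W : 0 <= a -> 0 <= b -> a + b = 1 ->
  G U -> G W -> G (a *: U + b *: W).
Proof.
move=> a0 b0 ab [rU pU] [rW pW].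
have pos (x y : R) : 0 < x -> 0 < y -> 0 < a * x + b * y.
    by case: (leP x y) => ? ? ?; nra.
have rUW := pos _ _ rU rW.
split; first by rewrite !stateE.
exact: lt_le_trans (pos _ _ pU pW) (pressure_concave a0 b0 rU rW rUW).
Qed.

Definition sound_speed U := Num.sqrt (gamma * p U / rho U).

Section Sound.
Variable U : 'rV[R]_4.
Hypothesis GU : G U.

Let rU : 0 < rho U := GU.1.
Let c2 : sound_speed U ^+ 2 = gamma * p U / rho U.
Proof.
case: GU => _ pU; have g_gt0 : 0 < gamma := lt_trans ltr01 g1.
by apply/sqr_sqrtr/ltW/divr_gt0 => //; apply: mulr_gt0.
Qed.

Lemma sound_speed_gt0 : 0 < sound_speed U.
Proof.
rewrite sqrtr_gt0 divr_gt0 // mulr_gt0 //; last by case: GU.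
exact: lt_trans g1.
Qed.

(** Of the eigenvalues v + c and v - c, the one whose acoustic term has the sign of v has modulus
    |v| + c. *)
Lemma euler_rad1_ge : `|vel1 U| + sound_speed U <= rad1 (euler_law gamma) U.
Proof.
have c0 := sound_speed_gt0; rewrite /=.
have [v0|v0] := leP 0 (vel1 U).
  have -> : `|vel1 U| + sound_speed U = `|vel1 U + sound_speed U|.
    by rewrite !ger0_norm //; nra.
  by apply/spectral_radius_ge/eigenvalue_flux1; rewrite ?gt_eqF.
have -> : `|vel1 U| + sound_speed U = `|vel1 U - sound_speed U|.
  by rewrite !ltr0_norm //; nra.
by apply/spectral_radius_ge/eigenvalue_flux1; rewrite ?sqrrN ?gt_eqF.
Qed.

Lemma euler_rad2_ge : `|vel2 U| + sound_speed U <= rad2 (euler_law gamma) U.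
Proof.
have c0 := sound_speed_gt0; rewrite /=.
have [v0|v0] := leP 0 (vel2 U).
  have -> : `|vel2 U| + sound_speed U = `|vel2 U + sound_speed U|.
    by rewrite !ger0_norm //; nra.
  by apply/spectral_radius_ge/eigenvalue_flux2; rewrite ?gt_eqF.
have -> : `|vel2 U| + sound_speed U = `|vel2 U - sound_speed U|.
  by rewrite !ltr0_norm //; nra.
by apply/spectral_radius_ge/eigenvalue_flux2; rewrite ?sqrrN ?gt_eqF.
Qed.

(** With s = 1 + b v, the hypothesis gives |b| c <= s. Squaring yields gamma b^2 p <= s^2 rho, which
    is stronger than the stated bound since gamma - 1 < 2 gamma. *)
Lemma characteristic_factor (b v : R) : b != 0 ->
  `|b| * (`|v| + sound_speed U) <= 1 ->
  0 < 1 + b * v /\ b ^+ 2 * p U < 2 * (1 + b * v) ^+ 2 * rho U / (gamma - 1).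
Proof.
move=> b0 bv; have c0 := sound_speed_gt0.
have s_ge : `|b| * sound_speed U <= 1 + b * v.
  have := ler_norm (- (b * v)); rewrite normrN normrM; nra.
have s0 : 0 < `|b| * sound_speed U by rewrite mulr_gt0 ?normr_gt0.
split; first exact: lt_le_trans s_ge.
have pU : 0 < p U by case: GU.
have b2 : 0 < b ^+ 2 by rewrite exprn_even_gt0.
have : b ^+ 2 * (gamma * p U / rho U) <= (1 + b * v) ^+ 2.
  rewrite -c2 -[b ^+ 2]real_normK ?num_real // -exprMn.
  by rewrite lerXn2r // nnegrE ltW // (lt_le_trans s0).
rewrite mulrA ler_pdivrMr // ltr_pdivlMr // => le_s.
have := mulr_gt0 (mulr_gt0 b2 pU) g0; have := mulr_gt0 b2 pU; lra.
Qed.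

(** As F(U) = v1 U + p (0, 1, 0, v1), the new state is s U + b p (0, 1, 0, v1) with s = 1 + b v1:
    the density is scaled by s, and the internal energy is scaled by s and loses b^2 p^2 / (2 s
    rho). *)
Lemma euler_G_flux1 b : b != 0 -> `|b| * (`|vel1 U| + sound_speed U) <= 1 ->
  G (U + b *: euler_flux1 gamma U).
Proof.
move=> b0 /(characteristic_factor b0)[s0 sp].
rewrite /euler_G !stateE.
have rE : rho U + b * (rho U * vel1 U) = rho U * (1 + b * vel1 U) by ring.
rewrite rE; split; first exact: mulr_gt0.
set s := 1 + _ in s0 sp *.
have -> : p (U + b *: euler_flux1 gamma U)
    = p U / (2 * s * rho U)
      * (2 * s ^+ 2 * rho U - (gamma - 1) * (b ^+ 2 * p U)).
  rewrite {1}/pressure !stateE rE -/s.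
  have -> : ener U
      = p U / (gamma - 1) + rho U * (vel1 U ^+ 2 + vel2 U ^+ 2) / 2.
    by rewrite /pressure /vel1 /vel2; field; rewrite !gt_eqF.
  have -> : mom1 U = rho U * vel1 U by rewrite /vel1; field; rewrite gt_eqF.
  have -> : mom2 U = rho U * vel2 U by rewrite /vel2; field; rewrite gt_eqF.
  rewrite /s; field; rewrite !gt_eqF //.
move: sp; rewrite ltr_pdivlMr // => sp.
apply: mulr_gt0; last by lra.
by apply: divr_gt0; [case: GU | rewrite !mulr_gt0].
Qed.
Lemma euler_G_flux2 b : b != 0 -> `|b| * (`|vel2 U| + sound_speed U) <= 1 ->
  G (U + b *: euler_flux2 gamma U).
Proof.
move=> b0 /(characteristic_factor b0)[s0 sp].
rewrite /euler_G !stateE.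
have rE : rho U + b * (rho U * vel2 U) = rho U * (1 + b * vel2 U) by ring.
rewrite rE; split; first exact: mulr_gt0.
set s := 1 + _ in s0 sp *.
have -> : p (U + b *: euler_flux2 gamma U)
    = p U / (2 * s * rho U)
      * (2 * s ^+ 2 * rho U - (gamma - 1) * (b ^+ 2 * p U)).
  rewrite {1}/pressure !stateE rE -/s.
  have -> : ener U
      = p U / (gamma - 1) + rho U * (vel1 U ^+ 2 + vel2 U ^+ 2) / 2.
    by rewrite /pressure /vel1 /vel2; field; rewrite !gt_eqF.
  have -> : mom1 U = rho U * vel1 U by rewrite /vel1; field; rewrite gt_eqF.
  have -> : mom2 U = rho U * vel2 U by rewrite /vel2; field; rewrite gt_eqF.
  rewrite /s; field; rewrite !gt_eqF //.
move: sp; rewrite ltr_pdivlMr // => sp.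
apply: mulr_gt0; last by lra.
by apply: divr_gt0; [case: GU | rewrite !mulr_gt0].
Qed.
End Sound.

Lemma llf_state_split (V : lmodType R) (F : V -> V) r (v w : V) :
  let b := (llf_speed r v w)^-1 in
  llf_state F r v w = 2^-1 *: (v + b *: F v) + 2^-1 *: (w - b *: F w).
Proof.
rewrite /llf_state /= invfM !scalerDr !scalerN !scalerA -!addrA.
by congr (_ + _); rewrite addrCA.
Qed.

Lemma euler_G_llf_state (F : 'rV[R]_4 -> 'rV[R]_4) r v w :
  (forall U, G U -> 0 < r U) ->
  (forall U b, G U -> b != 0 -> `|b| * r U <= 1 -> G (U + b *: F U)) ->
  G v -> G w -> G (llf_state F r v w).
Proof.
move=> r0 GF Gv Gw; rewrite llf_state_split -scaleNr.
have a0 : 0 < llf_speed r v w by rewrite lt_max r0.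
have b0 : 0 < (llf_speed r v w)^-1 by rewrite invr_gt0.
apply: euler_G_convex; rewrite ?invr_ge0 //.
- by rewrite [RHS]splitr mul1r.
- apply: GF => //; first by rewrite gt_eqF.
  by rewrite gtr0_norm // ler_pdivrMl // mulr1 le_max lexx.
- apply: GF => //; first by rewrite oppr_eq0 gt_eqF.
  by rewrite normrN gtr0_norm // ler_pdivrMl // mulr1 le_max lexx orbT.
Qed.

Lemma euler_G_llf_state1 v w : G v -> G w ->
  G (llf_state (euler_flux1 gamma) (rad1 (euler_law gamma)) v w).
Proof.
apply: euler_G_llf_state => [U GU|U b GU b0 br].
  apply: lt_le_trans (euler_rad1_ge GU).
  by rewrite ltr_wpDl ?sound_speed_gt0.
apply: euler_G_flux1 => //; apply: le_trans br.
by rewrite ler_wpM2l // euler_rad1_ge.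
Qed.

Lemma euler_G_llf_state2 v w : G v -> G w ->
  G (llf_state (euler_flux2 gamma) (rad2 (euler_law gamma)) v w).
Proof.
apply: euler_G_llf_state => [U GU|U b GU b0 br].
  apply: lt_le_trans (euler_rad2_ge GU).
  by rewrite ltr_wpDl ?sound_speed_gt0.
apply: euler_G_flux2 => //; apply: le_trans br.
by rewrite ler_wpM2l // euler_rad2_ge.
Qed.
End EulerAdmissible.

(** * Convex decomposition of the updates *)

Definition convex_pred (R : realType) (V : lmodType R) (G : V -> Prop) :=
  forall (a b : R) u v, 0 <= a -> 0 <= b -> a + b = 1 -> G u -> G v ->
  G (a *: u + b *: v).

Section ConvexUpdate.
Variables (R : realType) (V : lmodType R) (G : V -> Prop).
Hypothesis Gconv : convex_pred G.

Lemma convex_toward (u w : V) (a : R) : 0 <= a <= 1 -> G u -> G w ->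
  G (u + a *: (w - u)).
Proof.
move=> /andP[a0 a1] Gu Gw.
have -> : u + a *: (w - u) = (1 - a) *: u + a *: w.
  by rewrite scalerBl scale1r scalerBr addrAC addrA.
by apply: Gconv; rewrite ?subr_ge0 ?subrK.
Qed.

(** The two displacements add up to one step of length a + b toward the normalised mean of [v] and
    [w]. *)
Lemma convex_toward2 (u v w : V) (a b : R) : 0 <= a -> 0 <= b -> a + b <= 1 ->
  G u -> G v -> G w -> G (u + (a *: (v - u) + b *: (w - u))).
Proof.
move=> a0 b0 ab Gu Gv Gw.
(* The normalised mean does not exist when both weights vanish. *)
have [/eqP|s0] := eqVneq (a + b) 0.
  rewrite paddr_eq0 // => /andP[/eqP-> /eqP->].
  by rewrite !scale0r !addr0.
have s_gt0 : 0 < a + b by rewrite lt0r s0 addr_ge0.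
have -> : a *: (v - u) + b *: (w - u)
    = (a + b) *: ((a / (a + b)) *: v + (b / (a + b)) *: w - u).
  rewrite !scalerBr !scalerDr !scalerA ![(a + b) * _]mulrC !divfK //.
  by rewrite scalerDl opprD addrACA.
apply: convex_toward => //; first by rewrite ltW.
by apply: Gconv; rewrite ?divr_ge0 ?(ltW s_gt0) // -mulrDl divff.
Qed.

(** With X and Y the displacements in the two directions, u + X + Y is the midpoint of u + 2X and u
    + 2Y. Doubling the weights spends the factor 1/2 of (T1) and (T2). *)
Lemma convex_toward4 (u v1 v2 v3 v4 : V) (a1 a2 a3 a4 : R) :
  0 <= a1 -> 0 <= a2 -> 0 <= a3 -> 0 <= a4 ->
  a1 + a2 <= 2^-1 -> a3 + a4 <= 2^-1 ->
  G u -> G v1 -> G v2 -> G v3 -> G v4 ->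
  G (u + (a1 *: (v1 - u) + a2 *: (v2 - u))
       + (a3 *: (v3 - u) + a4 *: (v4 - u))).
Proof.
move=> a1_0 a2_0 a3_0 a4_0 a12 a34 Gu G1 G2 G3 G4.
have H12 : G (u + (2 * a1 *: (v1 - u) + 2 * a2 *: (v2 - u))).
  by apply: convex_toward2; rewrite ?mulr_ge0 //; lra.
have H34 : G (u + (2 * a3 *: (v3 - u) + 2 * a4 *: (v4 - u))).
  by apply: convex_toward2; rewrite ?mulr_ge0 //; lra.
have h0 : 0 <= 2^-1 :> R by rewrite invr_ge0.
have h1 : 2^-1 + 2^-1 = 1 :> R by rewrite [RHS]splitr mul1r.
have := Gconv h0 h0 h1 H12 H34; congr G.
rewrite !scalerDr !scalerA !mulKf ?pnatr_eq0 // addrACA -scalerDl h1 scale1r.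
by rewrite addrA.
Qed.

Section Face.
Variables (F : V -> V) (r : V -> R).

(* Both one-sided corrections of the intermediate state by the antidiffusive
   flux [Fh - F^L] are admissible: the sign - serves the left cell, + the right
   one. *)
Definition face_admissible (v w Fh : V) :=
  let D := (llf_speed r v w)^-1 *: (Fh - llf_flux F r v w) in
  G (llf_state F r v w - D) /\ G (llf_state F r v w + D).

Lemma sub_half (x y : V) : x - 2^-1 *: (x + y) = (2^-1 : R) *: (x - y).
Proof.
have h1 : 2^-1 + 2^-1 = 1 :> R by rewrite [RHS]splitr mul1r.
by rewrite scalerDr opprD addrA -{1}[x]scale1r -scalerBl -{1}h1 addrK -scalerBr.
Qed.

(** Together with [llf_flux_right], these are the jump conditions of a two-wave fan: the
    intermediate state is separated from [v] by a wave of speed -alpha and from [w] by one of speed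
    alpha. *)
Lemma llf_flux_left v w : 0 < llf_speed r v w ->
  llf_flux F r v w = F v + llf_speed r v w *: (v - llf_state F r v w).
Proof.
move=> a0; rewrite /llf_flux /llf_state; set a := llf_speed r v w in a0 *.
rewrite opprD addrA sub_half [in RHS]scalerBr !scalerA invfM.
rewrite [a * (_ * _)]mulrCA.
rewrite mulfV ?gt_eqF // mulr1 addrCA sub_half opprK addrC.
by rewrite -[w - v]opprB scalerN opprK [a * _]mulrC.
Qed.

Lemma llf_flux_right v w : 0 < llf_speed r v w ->
  llf_flux F r v w = F w + llf_speed r v w *: (llf_state F r v w - w).
Proof.
move=> a0; rewrite /llf_flux /llf_state; set a := llf_speed r v w in a0 *.
rewrite addrAC -[_ *: (v + w) - w]opprB [v + w]addrC sub_half.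
rewrite [in RHS]scalerDr scalerN !scalerA invfM [a * (_ * _)]mulrCA.
rewrite mulfV ?gt_eqF // mulr1 -[F v - F w]opprB scalerN addrCA.
by rewrite sub_half opprK addrC [F w + _]addrC [a * _]mulrC.
Qed.

Lemma llf_face_admissible v w : G (llf_state F r v w) ->
  face_admissible v w (llf_flux F r v w).
Proof. by rewrite /face_admissible subrr scaler0 subr0 addr0. Qed.

(* Relative to [F u] each face flux is a multiple of the distance from [u] to an
   admissible state, and [F u] cancels in [Fe - Fw]. *)
Lemma face_fluxB_mid l (w u e Fw Fe : V) : 0 <= l ->
  0 < llf_speed r w u -> 0 < llf_speed r u e ->
  face_admissible w u Fw -> face_admissible u e Fe ->
  exists2 v1, G v1 & exists2 v2, G v2 &
    - (l *: (Fe - Fw)) = (l * llf_speed r w u) *: (v1 - u)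
                     + (l * llf_speed r u e) *: (v2 - u).
Proof.
move=> l0 aw ae [_ Gw] [Ge _].
eexists; first exact: Gw.
eexists; first exact: Ge.
have Fe_E : Fe = llf_flux F r u e + (Fe - llf_flux F r u e) by rewrite subrKC.
have Fw_E : Fw = llf_flux F r w u + (Fw - llf_flux F r w u) by rewrite subrKC.
set De := Fe - _ in Fe_E *; set Dw := Fw - _ in Fw_E *.
clearbody De Dw.
rewrite Fe_E Fw_E (llf_flux_left ae) (llf_flux_right aw) -!scalerA -scalerDr.
rewrite -scalerN; congr (_ *: _).
set a := llf_speed r w u in aw *; set b := llf_speed r u e in ae *.
set x := llf_state F r w u; set y := llf_state F r u e.
have -> : a *: (x + a^-1 *: Dw - u) = a *: (x - u) + Dw.
  by rewrite addrAC scalerDr scalerA mulfV ?gt_eqF // scale1r.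
have -> : b *: (y - b^-1 *: De - u) = - (b *: (u - y) + De).
  rewrite addrAC scalerBr scalerA mulfV ?gt_eqF // scale1r opprD.
  by rewrite -scalerN opprB.
move: (a *: _) (b *: _) => A B.
rewrite opprB -(addrA _ A) -(addrA _ B) [in LHS]opprD.
by rewrite [LHS]addrACA subrr add0r.
Qed.
End Face.

(** Serves the cell averages with limited fluxes, and the low-order point values with the LLF fluxes
    themselves. *)
Lemma llf_update_in (F1 F2 : V -> V) r1 r2 (lx ly : R) u w e s n Fw Fe Fs Fn :
  0 <= lx -> 0 <= ly ->
  0 < llf_speed r1 w u -> 0 < llf_speed r1 u e ->
  0 < llf_speed r2 s u -> 0 < llf_speed r2 u n ->
  lx * (llf_speed r1 w u + llf_speed r1 u e) <= 2^-1 ->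
  ly * (llf_speed r2 s u + llf_speed r2 u n) <= 2^-1 ->
  G u ->
  face_admissible F1 r1 w u Fw -> face_admissible F1 r1 u e Fe ->
  face_admissible F2 r2 s u Fs -> face_admissible F2 r2 u n Fn ->
  G (u - lx *: (Fe - Fw) - ly *: (Fn - Fs)).
Proof.
move=> lx0 ly0 aw ae as_ an lxa lya Gu Hw He Hs Hn.
have [v1 G1 [v2 G2 ->]] := face_fluxB_mid lx0 aw ae Hw He.
have [v3 G3 [v4 G4 ->]] := face_fluxB_mid ly0 as_ an Hs Hn.
by apply: convex_toward4; rewrite -?mulrDr ?mulr_ge0 // ltW.
Qed.

End ConvexUpdate.

(** * Invariance of a convex set under the updates and SSP-RK3 *)

Section SchemeInvariance.
Variables (R : realType) (V : lmodType R) (m : mesh R) (L : law R V).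
Variable G : V -> Prop.
Hypothesis Gconv : convex_pred G.
Hypothesis G_llf1 : forall v w, G v -> G w ->
  G (llf_state (flux1 L) (rad1 L) v w).
Hypothesis G_llf2 : forall v w, G v -> G w ->
  G (llf_state (flux2 L) (rad2 L) v w).
Implicit Types (U : dofs V) (s : Defs.point).

Lemma dx_gt0 i : 0 < dx m i. Proof. by rewrite subr_gt0 xf_incr. Qed.
Lemma dy_gt0 j : 0 < dy m j. Proof. by rewrite subr_gt0 yf_incr. Qed.
Lemma hx_gt0 s : 0 < hx m s.
Proof.
by case: s => i j; do ?[exact: dx_gt0]; apply: divr_gt0 => //; apply: addr_gt0;
  exact: dx_gt0.
Qed.
Lemma hy_gt0 s : 0 < hy m s.
Proof.
by case: s => i j; do ?[exact: dy_gt0]; apply: divr_gt0 => //; apply: addr_gt0;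
  exact: dy_gt0.
Qed.

Lemma cfl_split (d h1 h2 a b c e : R) : 0 < h1 -> 0 < h2 ->
  0 < a -> 0 < b -> 0 < c -> 0 < e ->
  d <= 2^-1 * Num.min (h1 / (a + b)) (h2 / (c + e)) ->
  d / h1 * (a + b) <= 2^-1 /\ d / h2 * (c + e) <= 2^-1.
Proof.
move=> h1_0 h2_0 a0 b0 c0 e0 le_d.
have ab0 : 0 < a + b by rewrite addr_gt0.
have ce0 : 0 < c + e by rewrite addr_gt0.
have half0 : 0 <= 2^-1 :> R by rewrite invr_ge0.
split; rewrite mulrAC ler_pdivrMr // -ler_pdivlMr //.
  by apply: le_trans le_d _; rewrite -mulrA ler_wpM2l // ge_min lexx.
by apply: le_trans le_d _; rewrite -mulrA ler_wpM2l // ge_min lexx orbT.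
Qed.

Lemma point_stencil_in U s : all_in m (ng m) G U -> point_in m 0 s ->
  [/\ G (pt U s), G (pt U (east s)), G (pt U (west s)), G (pt U (north s)) &
      G (pt U (south s))].
Proof.
move=> [_ GU] s_in; have ng2 := ng_ge2 m.
by split; apply: GU; case: s s_in => i j /=; lia.
Qed.

(** The stencil is a hypothesis of its own, so that [G] may be an interval attached to the single
    point [s], which other degrees of freedom may leave. *)
Lemma point_low_in dt U s : 0 < dt -> stage_ok m L dt U -> point_in m 0 s ->
  [/\ G (pt U s), G (pt U (east s)), G (pt U (west s)), G (pt U (north s)) &
      G (pt U (south s))] -> G (point_low m L dt U s).
Proof.
move=> dt0 [[_ pos] _ cfl] s_in [Gs Ge Gw Gn Gs'].
have [aw ae as_ an] := pos s s_in.
have [lx ly] := cfl_split (hx_gt0 s) (hy_gt0 s) aw ae as_ an (cfl s s_in).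
apply: (llf_update_in Gconv (F1 := flux1 L) (F2 := flux2 L)
  (r1 := rad1 L) (r2 := rad2 L) (w := pt U (west s)) (e := pt U (east s))
  (s := pt U (south s)) (n := pt U (north s))) => //.
- by rewrite divr_ge0 ?(ltW (hx_gt0 s)) ?ltW.
- by rewrite divr_ge0 ?(ltW (hy_gt0 s)) ?ltW.
all: by apply: llf_face_admissible; [apply: G_llf1 || apply: G_llf2].
Qed.

Lemma cell_update_in (F1 F2 : int -> int -> V) dt U i j :
  0 < dt -> stage_ok m L dt U -> all_in m (ng m) G U -> cell_in m 0 i j ->
  (forall k, k = i \/ k = i - 1 -> face_admissible G (flux1 L) (rad1 L)
     (avg U k j) (avg U (k + 1) j) (F1 k j)) ->
  (forall k, k = j \/ k = j - 1 -> face_admissible G (flux2 L) (rad2 L)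
     (avg U i k) (avg U i (k + 1)) (F2 i k)) ->
  G (cell_update m F1 F2 dt U i j).
Proof.
move=> dt0 [[pos _] cfl _] [GU _] ij_in adm1 adm2.
have nij : near_mesh m i j by rewrite /near_mesh ij_in.
have [aw ae as_ an] := pos i j nij.
have [lx ly] := cfl_split (dx_gt0 i) (dy_gt0 j) aw ae as_ an (cfl i j ij_in).
have adm1w := adm1 _ (or_intror erefl); have adm1e := adm1 _ (or_introl erefl).
have adm2s := adm2 _ (or_intror erefl); have adm2n := adm2 _ (or_introl erefl).
rewrite /alpha1 /alpha2 ?subrK in aw ae as_ an lx ly adm1w adm2s.
apply: (llf_update_in Gconv (F1 := flux1 L) (F2 := flux2 L)
  (r1 := rad1 L) (r2 := rad2 L) (w := avg U (i - 1) j) (e := avg U (i + 1) j)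
  (s := avg U i (j - 1)) (n := avg U i (j + 1))) => //.
- by rewrite divr_ge0 ?(ltW (dx_gt0 i)) ?ltW.
- by rewrite divr_ge0 ?(ltW (dy_gt0 j)) ?ltW.
apply: GU; have ng2 := ng_ge2 m; move: ij_in; rewrite /cell_in; lia.
Qed.

Section RungeKutta.
Variables (S : R -> dofs V -> dofs V) (bc : nat -> nat -> dofs V -> dofs V).
Variables (dt : nat -> R) (U0 : dofs V).
Hypothesis dt_gt0 : forall n, 0 < dt n.
Hypothesis bcG : valid_bc m bc G.
Hypothesis S_in : forall d U, 0 < d -> stage_ok m L d U ->
  all_in m (ng m) G U -> all_in m 0 G (S d U).

Lemma comb_dofs_in (a b : R) U W : 0 <= a -> 0 <= b -> a + b = 1 ->
  all_in m 0 G U -> all_in m 0 G W -> all_in m 0 G (comb_dofs a b U W).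
Proof.
move=> a0 b0 ab [Ua Up] [Wa Wp].
split=> [i j ij|s ss]; apply: Gconv => //; auto.
Qed.

(** Only mesh values pass from stage to stage. Before each Euler step [bc] restores admissible ghost
    values, hence the passage from [ng m] layers to none in [S_in]. *)
Lemma level_in n : all_in m 0 G U0 -> stages_ok m S bc dt U0 L ->
  all_in m 0 G (level S bc dt U0 n).
Proof.
move=> GU0 ok; elim: n => [//|n IHn] /=.
have [ok1 ok2 ok3] := ok n.
have step k W : stage_ok m L (dt n) (bc n k W) -> all_in m 0 G W ->
    all_in m 0 G (S (dt n) (bc n k W)).
  by move=> okW GW; apply: S_in => //; apply: (bcG n k W).2.
have G1 := step _ _ ok1 IHn.
have G2 := step _ _ ok2 G1.
apply: comb_dofs_in => //; try lra.
by apply: step => //; apply: comb_dofs_in => //; lra.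
Qed.
End RungeKutta.
End SchemeInvariance.

(** * Finite minima and maxima, and the list of all degrees of freedom *)

Section FiniteExtrema.
Variable R : realType.
Implicit Types (x y : R) (s : seq R).

Lemma minl_mem x s : minl x s \in x :: s.
Proof.
rewrite /minl; elim: s => [|y s IHs]; first by rewrite big_nil mem_head.
rewrite big_cons minElt; case: ifP => _; first by rewrite !inE eqxx orbT.
by move: IHs; rewrite !inE => /orP[->//|->]; rewrite !orbT.
Qed.

Lemma maxl_mem x s : maxl x s \in x :: s.
Proof.
rewrite /maxl; elim: s => [|y s IHs]; first by rewrite big_nil mem_head.
rewrite big_cons maxElt; case: ifP => _; last by rewrite !inE eqxx orbT.
by move: IHs; rewrite !inE => /orP[->//|->]; rewrite !orbT.
Qed.

Lemma minl_le x s y : y \in x :: s -> minl x s <= y.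
Proof.
rewrite /minl; elim: s => [|z s IHs]; first by rewrite big_nil inE => /eqP->.
rewrite big_cons !inE ge_min orbCA => /orP[/eqP->|ys]; first by rewrite lexx.
by rewrite IHs ?orbT // inE.
Qed.

Lemma maxl_ge x s y : y \in x :: s -> y <= maxl x s.
Proof.
rewrite /maxl; elim: s => [|z s IHs]; first by rewrite big_nil inE => /eqP->.
rewrite big_cons !inE le_max orbCA => /orP[/eqP->|ys]; first by rewrite lexx.
by rewrite IHs ?orbT // inE.
Qed.
End FiniteExtrema.

Section AllDofs.
Variables (R : realType) (V : eqType) (m : mesh R).
Implicit Type U : dofs V.

Lemma mem_irange (a : int) n i : (i \in irange a n) = (a <= i < a + n%:Z).
Proof.
apply/mapP/idP => [[k]|i_in]; first by rewrite mem_iota => k_lt ->; lia.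
by exists `|i - a|%N; rewrite ?mem_iota; lia.
Qed.

Lemma mem_avg_all_dofs U i j :
  cell_in m (ng m) i j -> avg U i j \in all_dofs m U.
Proof.
move=> ij; rewrite /all_dofs !mem_cat; apply/orP; left.
by apply: allpairs_f; rewrite mem_irange; move: ij; rewrite /cell_in; lia.
Qed.

Lemma mem_pt_all_dofs U s : point_in m (ng m) s -> pt U s \in all_dofs m U.
Proof.
move=> s_in; rewrite /all_dofs mem_cat; apply/orP; right.
case: s s_in => i j ij.
- rewrite mem_cat; apply/orP; left.
  apply: (allpairs_f (fun i j => pt U (Corner i j)));
    rewrite mem_irange; move: ij => /=; lia.
- rewrite mem_cat; apply/orP; right; rewrite mem_cat; apply/orP; left.
  apply: (allpairs_f (fun i j => pt U (VFace i j)));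
    rewrite mem_irange; move: ij => /=; lia.
- rewrite mem_cat; apply/orP; right; rewrite mem_cat; apply/orP; right.
  apply: (allpairs_f (fun i j => pt U (HFace i j)));
    rewrite mem_irange; move: ij => /=; lia.
Qed.

Lemma all_dofs_in (G : V -> Prop) U v :
  all_in m (ng m) G U -> v \in all_dofs m U -> G v.
Proof.
move=> [Ga Gp]; rewrite mem_cat => /orP[|].
  move=> /allpairsPdep[i [j]]; rewrite !mem_irange => -[i_in j_in ->].
  by apply: Ga; rewrite /cell_in; lia.
rewrite mem_cat => /orP[|]; last rewrite mem_cat => /orP[|].
all: move=> /allpairsPdep[i [j]]; rewrite !mem_irange => -[i_in j_in ->].
all: by apply: Gp => /=; lia.
Qed.
End AllDofs.

(** * Scalar limiters *)

Section ScalarInvariance.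
Variables (R : realType).

Section ScalarFlux.
Variables (f : R -> R) (m0 M0 : R).
Hypothesis df : forall u, scalar_G m0 M0 u -> derivable f u 1.
Let r u := `|derive1 f u|.
Hypothesis dom : llf_speed_dominates (scalar_G m0 M0) r.

(** The mean value theorem yields a slope at a point between [v] and [w], and [dom] bounds it by the
    larger of the slopes at the ends. *)
Lemma scalar_flux_lipschitz v w : scalar_G m0 M0 v -> scalar_G m0 M0 w ->
  `|f v - f w| <= llf_speed r v w * `|v - w|.
Proof.
wlog: v w / v <= w => [H|vw] Gv Gw.
  have [/H->//|/ltW wv] := leP v w.
  by rewrite distrC (distrC v) /llf_speed maxC; apply: H.
have inG x : x \in `[v, w] -> scalar_G m0 M0 x.
  rewrite in_itv /= => /andP[vx xw]; move/andP: Gv => [v0 _].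
  move/andP: Gw => [_ w0].
  by rewrite /scalar_G (le_trans v0 vx) (le_trans xw w0).
have cf : {within `[v, w], continuous f}%classic.
  apply: derivable_within_continuous => x xvw; exact: df (inG x xvw).
have [|c c_in fE] := MVT_segment vw _ cf (df := derive1 f).
  move=> x x_in; rewrite derive1E; apply: derivableP; apply/df/inG.
  exact: subset_itv_oo_cc x_in.
rewrite distrC fE normrM (distrC v) ler_wpM2r //.
apply: dom => //; move: c_in; rewrite in_itv /= => /andP[vc cw].
by rewrite ge_min le_max vc cw orbT.
Qed.

Lemma scalar_llf_state_between v w : scalar_G m0 M0 v -> scalar_G m0 M0 w ->
  Num.min v w <= llf_state f r v w <= Num.max v w.
Proof.
move=> Gv Gw; have lip := scalar_flux_lipschitz Gv Gw.
rewrite /llf_state; set a := llf_speed r v w in lip *.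
have a0 : 0 <= a by rewrite le_max normr_ge0.
pose k := (2 * a)^-1 * (f v - f w).
rewrite /GRing.scale /= -/k.
have k_le : `|k| <= `|v - w| / 2.
  (* For zero viscosity the inverse is 0 by convention, and the state is the plain midpoint. *)
  have [a_eq0|an0] := eqVneq a 0.
    by rewrite /k a_eq0 mulr0 invr0 mul0r normr0 divr_ge0.
  have a_gt0 : 0 < a by rewrite lt0r an0.
  rewrite /k normrM gtr0_norm ?invr_gt0 ?mulr_gt0 //.
  rewrite ler_pdivrMl ?mulr_gt0 // (le_trans lip) //.
  by rewrite le_eqVlt; apply/orP; left; apply/eqP; field.
move: k_le; rewrite ler_norml => /andP[k1 k2].
have [vw|wv] := leP v w.
  move: k1 k2; rewrite ler0_norm ?subr_le0 // => k1 k2.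
  by apply/andP; split; lra.
move: k1 k2; rewrite gtr0_norm ?subr_gt0 // => k1 k2.
by apply/andP; split; lra.
Qed.

(** Stated for subintervals, since global and local limiter bounds may be tighter than the initial
    extrema. *)
Lemma scalar_G_llf_state a b v w : m0 <= a -> b <= M0 ->
  scalar_G a b v -> scalar_G a b w -> scalar_G a b (llf_state f r v w).
Proof.
move=> ma bM Gv Gw; rewrite /scalar_G in Gv Gw *.
have /andP[av vb] := Gv; have /andP[aw wb] := Gw.
have inG x : a <= x <= b -> scalar_G m0 M0 x by rewrite /scalar_G; lra.
have /andP[lo hi] := scalar_llf_state_between (inG v Gv) (inG w Gw).
apply/andP; split; first by apply: le_trans lo; rewrite le_min av aw.
by apply: le_trans hi _; rewrite ge_max vb wb.
Qed.

(** A correction D >= 0 lowers the left state and raises the right one, so only the left minimum and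
    the right maximum can be violated; for D <= 0 the roles are exchanged. The limiter caps |D| by
    alpha times these two distances. *)
Lemma scalar_face_admissible v w fH mnl mxl mnr mxr :
  let ut := llf_state f r v w in
  0 < llf_speed r v w ->
  mnl <= ut <= mxl -> mnr <= ut <= mxr ->
  m0 <= mnl -> m0 <= mnr -> mxl <= M0 -> mxr <= M0 ->
  face_admissible (scalar_G m0 M0) f r v w
    (scalar_flux_lim (llf_speed r v w) ut (llf_flux f r v w) fH
       mnl mxl mnr mxr).
Proof.
move=> ut a0 /andP[l1 l2] /andP[r1 r2] b1 b2 b3 b4.
rewrite /face_admissible /scalar_flux_lim -/ut.
set a := llf_speed r v w in a0 *; set fL := llf_flux f r v w.
set D := (X in fL + X); have -> : fL + D - fL = D by rewrite addrAC subrr add0r.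
rewrite /GRing.scale /=.
have DE : D = a * (a^-1 * D) by rewrite mulrA mulfV ?gt_eqF // mul1r.
have DP : (0 <= D /\ D <= a * Num.min (ut - mnl) (mxr - ut)) \/
    (D <= 0 /\ a * Num.max (mnr - ut) (ut - mxl) <= D).
  rewrite /D; case: (leP 0 (fH - fL)) => d0; [left | right]; split.
  - by rewrite le_min d0 mulr_ge0 ?(ltW a0) // le_min !subr_ge0 l1 r2.
  - by rewrite ge_min lexx orbT.
  - by rewrite ge_max (ltW d0) pmulr_rle0 // ge_max !subr_le0 r1 l2.
  - by rewrite le_max lexx orbT.
rewrite /scalar_G; move: DP; rewrite DE; move: (a^-1 * D) => q.
rewrite !(pmulr_rge0, pmulr_rle0, ler_pM2l) // le_min ge_max.
by rewrite mulKf ?gt_eqF //; case=> -[? /andP[? ?]]; split; lra.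
Qed.
End ScalarFlux.
End ScalarInvariance.

(** * The limited scalar step *)

Section ScalarScheme.
Variables (R : realType) (f1 f2 : R -> R) (m0 M0 : R).
Notation G := (scalar_G m0 M0).
Notation L := (scalar_law f1 f2).
Hypothesis df1 : forall u, G u -> derivable f1 u 1.
Hypothesis df2 : forall u, G u -> derivable f2 u 1.
Hypothesis dom1 : llf_speed_dominates G (rad1 L).
Hypothesis dom2 : llf_speed_dominates G (rad2 L).
Variables (m : mesh R) (H : high_order R) (cellN ptN : bounds_kind).
Variable U : dofs R.
Hypothesis GU : all_in m (ng m) G U.

Lemma scalar_tilde1_in a b i j : m0 <= a -> b <= M0 ->
  scalar_G a b (avg U i j) -> scalar_G a b (avg U (i + 1) j) ->
  scalar_G a b (tilde1 L U i j).
Proof. exact: scalar_G_llf_state. Qed.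

Lemma scalar_tilde2_in a b i j : m0 <= a -> b <= M0 ->
  scalar_G a b (avg U i j) -> scalar_G a b (avg U i (j + 1)) ->
  scalar_G a b (tilde2 L U i j).
Proof. exact: scalar_G_llf_state. Qed.

Lemma all_entries_bounds (G' : R -> Prop) x s : G' x ->
  (forall y, y \in s -> G' y) -> G' (minl x s) /\ G' (maxl x s).
Proof.
move=> Gx Gs; have Gxs y : y \in x :: s -> G' y.
  by rewrite inE => /orP[/eqP->//|/Gs].
by split; apply: Gxs; rewrite ?minl_mem ?maxl_mem.
Qed.

Lemma avg11_in : cell_in m (ng m) 1 1.
Proof. by have := N1_gt0 m; have := N2_gt0 m; rewrite /cell_in; lia. Qed.

(** The cell may be a ghost cell of the first layer, whose neighbours still lie in the window
    because [ng] is at least 2. *)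
Lemma cell_bounds i j : cell_in m 1 i j ->
  let mn := cell_min f1 f2 m cellN U i j in
  let mx := cell_max f1 f2 m cellN U i j in
  m0 <= mn /\ mx <= M0 /\
  forall ut, ut \in [:: tilde1 L U i j; tilde1 L U (i - 1) j;
                        tilde2 L U i j; tilde2 L U i (j - 1)] ->
    mn <= ut <= mx.
Proof.
move=> ij mn mx.
have cin k l : k \in [:: i - 1; i; i + 1] -> l \in [:: j - 1; j; j + 1] ->
    cell_in m (ng m) k l.
  have := ng_ge2 m; move: ij; rewrite !inE /cell_in; lia.
have ei : i - 1 + 1 = i by rewrite subrK.
have ej : j - 1 + 1 = j by rewrite subrK.
have Gavg k l : k \in [:: i - 1; i; i + 1] -> l \in [:: j - 1; j; j + 1] ->
    G (avg U k l) by move=> k_in l_in; apply: GU.1; apply: cin.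
have tin a b : m0 <= a -> b <= M0 ->
    (forall k l, k \in [:: i - 1; i; i + 1] -> l \in [:: j - 1; j; j + 1] ->
      scalar_G a b (avg U k l)) ->
    forall ut, ut \in [:: tilde1 L U i j; tilde1 L U (i - 1) j;
                          tilde2 L U i j; tilde2 L U i (j - 1)] ->
    scalar_G a b ut.
  move=> a_ge b_le Gab ut; rewrite !inE => /or4P[]/eqP->;
    [apply: scalar_tilde1_in|apply: scalar_tilde1_in
    |apply: scalar_tilde2_in|apply: scalar_tilde2_in] => //;
    apply: Gab; rewrite ?ei ?ej !inE eqxx ?orbT //.
suff [[Gmn Gmx] sub] : (G mn /\ G mx) /\ forall ut,
    ut \in [:: tilde1 L U i j; tilde1 L U (i - 1) j;
               tilde2 L U i j; tilde2 L U i (j - 1)] -> mn <= ut <= mx.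
  by case/andP: Gmn => ? _; case/andP: Gmx.
have GT := tin _ _ (lexx m0) (lexx M0) Gavg.
rewrite {}/mn {}/mx /cell_min /cell_max /cell_base /cell_nbhd.
case: cellN.
  (* The global list omits the intermediate states; they obey its bounds because the averages that
     produce them do. *)
  have GNs y : y \in all_dofs m U -> G y by apply: all_dofs_in.
  have [Gmn Gmx] := all_entries_bounds (GU.1 _ _ avg11_in) GNs.
  split=> //; apply: tin; [by case/andP: Gmn|by case/andP: Gmx|].
  move=> k l k_in l_in; have kl := cin k l k_in l_in.
  by rewrite /scalar_G minl_le ?maxl_ge // inE mem_avg_all_dofs ?orbT.
split; last first.
  move=> ut ut_in; have ut_in' : ut \in avg U i j :: [:: tilde1 L U i j;
     tilde1 L U (i - 1) j; tilde2 L U i j; tilde2 L U i (j - 1);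
     avg U (i + 1) j; avg U (i - 1) j; avg U i (j + 1); avg U i (j - 1)].
    by move: ut_in; rewrite !inE => /or4P[]->; rewrite ?orbT.
  by rewrite minl_le ?maxl_ge.
apply: all_entries_bounds; first by apply: Gavg; rewrite !inE eqxx ?orbT.
(* The first four entries are intermediate states, the other four neighbouring averages. *)
move=> y; rewrite -[X in _ \in X](cat_take_drop 4) mem_cat /= => /orP[/GT//|].
by rewrite !inE => /or4P[]/eqP->; apply: Gavg; rewrite !inE eqxx ?orbT.
Qed.

Lemma scalar_lim1_admissible i j : cell_in m 1 i j -> cell_in m 1 (i + 1) j ->
  0 < alpha1 L U i j ->
  face_admissible G (flux1 L) (rad1 L) (avg U i j) (avg U (i + 1) j)
    (scalar_lim1 f1 f2 m H cellN U i j).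
Proof.
move=> /cell_bounds[l1 [l2 l3]] /cell_bounds[r1 [r2 r3]] a0.
apply: scalar_face_admissible => //; first by apply: l3; rewrite inE eqxx.
by apply: r3; rewrite addrK !inE eqxx orbT.
Qed.

Lemma scalar_lim2_admissible i j : cell_in m 1 i j -> cell_in m 1 i (j + 1) ->
  0 < alpha2 L U i j ->
  face_admissible G (flux2 L) (rad2 L) (avg U i j) (avg U i (j + 1))
    (scalar_lim2 f1 f2 m H cellN U i j).
Proof.
move=> /cell_bounds[l1 [l2 l3]] /cell_bounds[r1 [r2 r3]] a0.
apply: scalar_face_admissible => //.
  by apply: l3; rewrite !inE eqxx ?orbT.
by apply: r3; rewrite addrK !inE eqxx !orbT.
Qed.

Lemma scalar_G_convex (a b : R) : convex_pred (scalar_G a b).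
Proof.
move=> s t u v s0 t0 st /andP[u1 u2] /andP[v1 v2].
rewrite /scalar_G /GRing.scale /= (_ : s = 1 - t); last by lra.
have t1 : 0 <= 1 - t by lra.
by apply/andP; split; nra.
Qed.

(** Only the bound on the side of [uH] can bind. The quotient for that side is nonnegative, so its
    absolute value is harmless, and it caps t |uH - uL| by the distance from [uL] to that bound. *)
Lemma scalar_theta_between (uL uH mn mx : R) : mn <= uL <= mx ->
  let t := scalar_point_theta uL uH mn mx in
  mn <= t * uH + (1 - t) * uL <= mx.
Proof.
move=> /andP[lo hi]; rewrite /= /scalar_point_theta.
have [->|neq] := eqVneq uH uL; first by rewrite mul1r subrr mul0r addr0 lo.
set t := Num.min 1 _.
have t0 : 0 <= t by rewrite !le_min ler01 !normr_ge0.
have t1 : t <= 1 by rewrite ge_min lexx.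
have [ltHL|ltLH|//] := ltgtP uH uL; last by move: neq => /eqP.
  have : t <= `|(uL - mn) / (uL - uH)| by rewrite !ge_min lexx !orbT.
  rewrite ger0_norm; last by rewrite divr_ge0 ?subr_ge0 // ltW.
  rewrite ler_pdivlMr ?subr_gt0 //.
  nra.
have : t <= `|(mx - uL) / (uH - uL)| by rewrite !ge_min lexx !orbT.
rewrite ger0_norm; last by rewrite divr_ge0 ?subr_ge0 // ltW.
rewrite ler_pdivlMr ?subr_gt0 //.
nra.
Qed.

Lemma scalar_point_bounds s : point_in m 0 s ->
  let mn := point_min m ptN U s in let mx := point_max m ptN U s in
  [/\ m0 <= mn, mx <= M0 &
     [/\ scalar_G mn mx (pt U s), scalar_G mn mx (pt U (east s)),
      scalar_G mn mx (pt U (west s)), scalar_G mn mx (pt U (north s)) &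
      scalar_G mn mx (pt U (south s))]].
Proof.
move=> s_in mn mx.
have Gst := point_stencil_in GU s_in.
have nb : [/\ pt U s \in point_base ptN U s :: point_nbhd m ptN U s,
    pt U (east s) \in point_base ptN U s :: point_nbhd m ptN U s,
    pt U (west s) \in point_base ptN U s :: point_nbhd m ptN U s,
    pt U (north s) \in point_base ptN U s :: point_nbhd m ptN U s &
    pt U (south s) \in point_base ptN U s :: point_nbhd m ptN U s].
  rewrite /point_base /point_nbhd; case: ptN; last first.
    by split; rewrite !inE eqxx ?orbT.
  (* The stencil lemma holds for any predicate; here it is membership in the list. *)
  have AU : all_in m (ng m) (fun v => v \in all_dofs m U) U.
    by split=> *; [apply: mem_avg_all_dofs | apply: mem_pt_all_dofs].
  have [? ? ? ? ?] := point_stencil_in AU s_in.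
  by split; rewrite inE; apply/orP; right.
have [Gmn Gmx] : G mn /\ G mx.
  rewrite /mn /mx /point_min /point_max /point_base /point_nbhd.
  case: ptN; apply: all_entries_bounds.
  - exact: GU.1 avg11_in.
  - by move=> y; apply: all_dofs_in.
  - by case: Gst.
  - by case: Gst => ? ? ? ? ? y; rewrite !inE => /or4P[]/eqP->.
case/andP: Gmn => ? _; case/andP: Gmx => _ ?; split=> //.
by case: nb => *; split; rewrite /scalar_G minl_le ?maxl_ge.
Qed.

Lemma scalar_step_in dt : 0 < dt -> stage_ok m L dt U ->
  all_in m 0 G (scalar_step f1 f2 m H cellN ptN dt U).
Proof.
move=> dt0 ok; split=> [i j ij|s s_in] /=.
  have cin k l : k \in [:: i - 1; i; i + 1] -> l \in [:: j - 1; j; j + 1] ->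
      cell_in m 1 k l.
    by move: ij; rewrite !inE /cell_in; lia.
  have [[pos _] _ _] := ok; have [|aw ae as_ an] := pos i j.
    by rewrite /near_mesh ij.
  apply: (cell_update_in (scalar_G_convex (b := M0)) dt0 ok GU ij).
    move=> k k_i; apply: scalar_lim1_admissible; last by case: k_i => ->.
      by apply: cin; rewrite !inE ?eqxx ?orbT //; lia.
    by apply: cin; rewrite !inE ?eqxx ?orbT //; lia.
  move=> k k_i; apply: scalar_lim2_admissible; last by case: k_i => ->.
    by apply: cin; rewrite !inE ?eqxx ?orbT //; lia.
  by apply: cin; rewrite !inE ?eqxx ?orbT //; lia.
have [mn_ge mx_le Gst] := scalar_point_bounds s_in.
(* The invariant convex set is now the interval of the limiter at [s], not [m0, M0]. *)
have uL : scalar_G (point_min m ptN U s) (point_max m ptN U s)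
    (point_low m L dt U s).
  apply: point_low_in => //; first exact: scalar_G_convex.
    by move=> v w; exact: (scalar_G_llf_state df1 dom1 mn_ge mx_le).
  by move=> v w; exact: (scalar_G_llf_state df2 dom2 mn_ge mx_le).
have /andP[lo hi] := scalar_theta_between (point_high H dt U s) uL.
by apply/andP; split; [apply: le_trans lo | apply: le_trans hi _].
Qed.

End ScalarScheme.

(** * Euler limiters *)

Section EulerLimiters.
Variables (R : realType) (gamma : R).
Hypothesis g1 : 1 < gamma.
Notation G := (euler_G gamma).
Notation p := (pressure gamma).

Lemma limiter_theta_bounds (A B C : R) : 0 <= C ->
  let den := Num.max 0 A + `|B| in
  let t := if den == 0 then 1 else Num.min 1 (C / den) in
  [/\ 0 <= t, t <= 1 & t ^+ 2 * A + t * `|B| <= C].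
Proof.
move=> C0 den t.
have A_le : A <= Num.max 0 A by rewrite le_max lexx orbT.
have A_ge : 0 <= Num.max 0 A by rewrite le_max lexx.
have B0 := normr_ge0 B.
have den0 : 0 <= den by rewrite addr_ge0.
have [t0 t1 tC] : [/\ 0 <= t, t <= 1 & t * den <= C].
  rewrite /t; have [->|dn0] := eqVneq den 0; first by rewrite mulr0.
  have den_gt0 : 0 < den by rewrite lt0r dn0.
  split; first by rewrite le_min ler01 divr_ge0.
    by rewrite ge_min lexx.
  by rewrite -ler_pdivlMr // ge_min lexx orbT.
split=> //; apply: le_trans tC; rewrite /den mulrDr lerD2r.
have : t ^+ 2 * A <= t ^+ 2 * Num.max 0 A by rewrite ler_wpM2l ?sqr_ge0.
move=> h; apply: le_trans h _.
by rewrite expr2 -mulrA ler_piMl // mulr_ge0.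
Qed.

Lemma clip_bounds (d b : R) : 0 <= b ->
  `|if 0 <= d then Num.min d b else Num.max d (- b)| <= b.
Proof.
move=> b0; rewrite ler_norml; case: (leP 0 d) => d0.
  by rewrite le_min ge_min lexx orbT; lra.
by rewrite le_max ge_max lexx orbT; lra.
Qed.

(** The first limiting keeps both densities at least [er], and scaling [D] by a factor at most 1
    preserves this. The second controls the pressure starting from C >= 0, which says that the
    intermediate state itself has pressure at least [ep]. *)
Lemma euler_face_admissible F r v w FH er ep :
  let ut := llf_state F r v w in let a := llf_speed r v w in
  0 < a -> 0 < er <= rho ut -> 0 < ep <= p ut ->
  face_admissible G F r v w
    (euler_flux_lim gamma a ut (llf_flux F r v w) FH er ep).
Proof.
move=> ut a a0 /andP[er0 er_le] /andP[ep0 ep_le].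
rewrite /face_admissible -/ut -/a; set FL := llf_flux F r v w.
rewrite /euler_flux_lim.
set dlim := (if 0 <= _ then _ else _).
set D := state4 _ _ _ _ - FL.
have rD : `|rho D| <= a * (rho ut - er).
  have -> : rho D = dlim by rewrite /D !stateE addrAC subrr add0r.
  rewrite /dlim -[er - _]opprB mulrN.
  by apply: clip_bounds; rewrite mulr_ge0 ?subr_ge0 // ltW.
set et := ep / (gamma - 1).
set A := _ / 2 - rho D * ener D.
set B := a * _.
set C := a ^+ 2 * _.
have ru0 : 0 < rho ut by apply: lt_le_trans er_le.
have g0 : 0 < gamma - 1 by rewrite subr_gt0.
have et0 : 0 < et by rewrite divr_gt0.
have et_le : 0 <=
    rho ut * ener ut - (mom1 ut ^+ 2 + mom2 ut ^+ 2) / 2 - et * rho ut.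
  suff -> : rho ut * ener ut - (mom1 ut ^+ 2 + mom2 ut ^+ 2) / 2 - et * rho ut
      = rho ut / (gamma - 1) * (p ut - ep).
    by rewrite mulr_ge0 ?divr_ge0 ?subr_ge0 // ltW.
  by rewrite /et /pressure; field; rewrite !gt_eqF.
have C0 : 0 <= C by rewrite mulr_ge0 ?sqr_ge0.
have [t0 t1 tC] := limiter_theta_bounds A B C0.
set t := (if _ then _ else _) in t0 t1 tC *.
rewrite [FL + _]addrC addrK scalerA.
clearbody ut D.
(* Both signs are treated at once: s^2 = 1 leaves the quadratic term unchanged, and |B| absorbs the
   sign of the linear one. *)
have Gs s : `|s| = 1 -> G (ut + (s * (a^-1 * t)) *: D).
  move=> s1; set b := s * _.
  have s2 : s ^+ 2 = 1 by rewrite -real_normK ?num_real // s1 expr1n.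
  have abE : a * b = s * t by rewrite /b mulrCA mulVKf // gt_eqF.
  have r'0 : 0 < rho ut + b * rho D.
    rewrite -(pmulr_rgt0 _ a0) mulrDr mulrA abE.
    have : `|s * t * rho D| <= a * (rho ut - er).
      by rewrite !normrM s1 mul1r ger0_norm // (le_trans _ rD) // ler_piMl.
    rewrite ler_norml => /andP[lo _]; have := mulr_gt0 a0 er0; lra.
  apply/(euler_GP g1); rewrite !stateE; split=> //.
  have : 0 <= C + s * t * B - (s * t) ^+ 2 * A.
    have : `|s * t * B| <= t * `|B| by rewrite !normrM s1 mul1r ger0_norm.
    by rewrite exprMn s2 mul1r ler_norml => /andP[lo _]; lra.
  (* [C + s t B - (s t)^2 A] is [a^2] times [rho * (rho e - et)] at the
     corrected state, whatever the sign [s]. *)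
  have -> : C + s * t * B - (s * t) ^+ 2 * A = a ^+ 2 *
    ((rho ut + b * rho D) * (ener ut + b * ener D)
     - ((mom1 ut + b * mom1 D) ^+ 2 + (mom2 ut + b * mom2 D) ^+ 2) / 2
     - et * (rho ut + b * rho D)).
    by rewrite -abE /A /B /C; field.
  rewrite pmulr_rge0 ?exprn_gt0 //; have := mulr_gt0 et0 r'0; lra.
split; last by rewrite -[a^-1 * t]mul1r; apply: Gs; rewrite normr1.
by rewrite -scaleNr -mulN1r; apply: Gs; rewrite normrN1.
Qed.

(** When active, [theta1] makes the density exactly [er], and [theta2] makes the linear
    interpolation of the two pressures exactly [ep]. By concavity the pressure of the blend is at
    least that. *)
Lemma euler_point_limit (UL UH : 'rV[R]_4) (e1 e2 : R) : G UL ->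
  0 < e1 -> 0 < e2 ->
  let er := minl (eps0 R) [:: e1; rho UL] in
  let ep := minl (eps0 R) [:: e2; p UL] in
  let theta1 := if rho UH < er then (rho UL - er) / (rho UL - rho UH) else 1 in
  let Ustar := state4 (theta1 * rho UH + (1 - theta1) * rho UL)
                      (mom1 UH) (mom2 UH) (ener UH) in
  let theta2 := if p Ustar < ep
                then (p UL - ep) / (p UL - p Ustar) else 1 in
  G (theta2 *: Ustar + (1 - theta2) *: UL).
Proof.
move=> [rL pL] e1_0 e2_0 er ep theta1 Ustar theta2.
have eps0_gt0 : 0 < eps0 R by rewrite /eps0 invr_gt0 exprn_gt0.
have pos (e x : R) : 0 < e -> 0 < x -> 0 < minl (eps0 R) [:: e; x].
  move=> e0 x0; have := minl_mem (eps0 R) [:: e; x].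
  by rewrite !inE => /or3P[]/eqP->.
have er0 : 0 < er by apply: pos.
have ep0 : 0 < ep by apply: pos.
have er_le : er <= rho UL by apply: minl_le; rewrite !inE eqxx !orbT.
have ep_le : ep <= p UL by apply: minl_le; rewrite !inE eqxx !orbT.
have rS : 0 < rho Ustar.
  rewrite /Ustar stateE /theta1; case: (ltP (rho UH) er) => [lt_er|le_er].
    have -> : (rho UL - er) / (rho UL - rho UH) * rho UH
        + (1 - (rho UL - er) / (rho UL - rho UH)) * rho UL = er; last by [].
    clearbody er; field.
    by rewrite subr_eq0 gt_eqF // (lt_le_trans lt_er).
  by rewrite mul1r subrr mul0r addr0 (lt_le_trans er0).
rewrite /theta2; case: (ltP (p Ustar) ep) => [lt_ep|le_ep]; last first.
  by rewrite subrr scale0r addr0 scale1r; split=> //; apply: lt_le_trans le_ep.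
clear theta2; clearbody Ustar; set t := _ / _.
have d0 : 0 < p UL - p Ustar by rewrite subr_gt0 (lt_le_trans lt_ep).
have t0 : 0 <= t by apply: divr_ge0; [rewrite subr_ge0 | exact: ltW].
have t1 : 0 <= 1 - t.
  by rewrite subr_ge0 ler_pdivrMr // mul1r lerD2l lerN2 ltW.
have r0 : 0 < t * rho Ustar + (1 - t) * rho UL.
  by case: (leP (rho Ustar) (rho UL)) => ?; nra.
split; first by rewrite !stateE.
apply: lt_le_trans (pressure_concave g1 t0 t1 rS rL r0).
have -> : t * p Ustar + (1 - t) * p UL = ep; last by [].
rewrite /t; clearbody ep; field.
by rewrite gt_eqF.
Qed.
End EulerLimiters.

(** * The limited Euler step *)

Section EulerScheme.
Variables (R : realType) (gamma : R).
Hypothesis g1 : 1 < gamma.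
Notation G := (euler_G gamma).
Notation L := (euler_law gamma).
Variables (m : mesh R) (H : high_order 'rV[R]_4) (U : dofs 'rV[R]_4).
Hypothesis GU : all_in m (ng m) G U.

Lemma eps0_gt0 : 0 < eps0 R.
Proof. by rewrite /eps0 invr_gt0 exprn_gt0. Qed.

Lemma minl_gt0 (x : R) s : 0 < x -> (forall y, y \in s -> 0 < y) ->
  0 < minl x s.
Proof.
move=> x0 s0; have := minl_mem x s.
by rewrite inE => /orP[/eqP->//|/s0].
Qed.

Lemma eps_rho_gt0 : 0 < eps_rho m U.
Proof.
apply: minl_gt0; first by case: (GU.1 _ _ (avg11_in m)).
by move=> _ /mapP[W W_in ->]; case: (all_dofs_in GU W_in).
Qed.

Lemma eps_p_gt0 : 0 < eps_p gamma m U.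
Proof.
apply: minl_gt0; first by case: (GU.1 _ _ (avg11_in m)).
by move=> _ /mapP[W W_in ->]; case: (all_dofs_in GU W_in).
Qed.

Lemma cell_eps_bounds i j : cell_in m 1 i j ->
  [/\ 0 < cell_eps_rho gamma m U i j, 0 < cell_eps_p gamma m U i j &
    forall W, W \in adjacent_tildes gamma U i j ->
      cell_eps_rho gamma m U i j <= rho W /\
      cell_eps_p gamma m U i j <= pressure gamma W].
Proof.
move=> ij.
have cin k l : k \in [:: i - 1; i; i + 1] -> l \in [:: j - 1; j; j + 1] ->
    G (avg U k l).
  move=> k_in l_in; apply: GU.1.
  have := ng_ge2 m; move: ij k_in l_in; rewrite !inE /cell_in; lia.
have ei : i - 1 + 1 = i by rewrite subrK.
have ej : j - 1 + 1 = j by rewrite subrK.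
have Gt W : W \in adjacent_tildes gamma U i j -> G W.
  rewrite !inE => /or4P[]/eqP->;
    [apply: euler_G_llf_state1|apply: euler_G_llf_state1
    |apply: euler_G_llf_state2|apply: euler_G_llf_state2] => //;
    by apply: cin; rewrite ?ei ?ej !inE eqxx ?orbT.
split.
- apply: minl_gt0; first exact: eps0_gt0.
  move=> y; rewrite in_cons => /orP[/eqP->|/mapP[W W_in ->]].
    exact: eps_rho_gt0.
  by case: (Gt W W_in).
- apply: minl_gt0; first exact: eps0_gt0.
  move=> y; rewrite in_cons => /orP[/eqP->|/mapP[W W_in ->]].
    exact: eps_p_gt0.
  by case: (Gt W W_in).
move=> W W_in; split; apply: minl_le; rewrite in_cons; apply/orP; right;
  rewrite in_cons; apply/orP; right.
  by apply: (map_f (@rho R)).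
by apply: (map_f (pressure gamma)).
Qed.

Lemma euler_lim1_admissible i j : cell_in m 1 i j -> cell_in m 1 (i + 1) j ->
  0 < alpha1 L U i j ->
  face_admissible G (flux1 L) (rad1 L) (avg U i j) (avg U (i + 1) j)
    (euler_lim1 gamma m H U i j).
Proof.
move=> /cell_eps_bounds[l1 l2 l3] /cell_eps_bounds[r1 r2 r3] a0.
(* The left cell alone suffices, because the threshold at the face is the minimum of both cells'
   thresholds. *)
have [|ler lep] := l3 (tilde1 L U i j); first by rewrite inE eqxx.
apply: euler_face_admissible => //.
  by rewrite lt_min l1 r1 ge_min ler.
by rewrite lt_min l2 r2 ge_min lep.
Qed.

Lemma euler_lim2_admissible i j : cell_in m 1 i j -> cell_in m 1 i (j + 1) ->
  0 < alpha2 L U i j ->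
  face_admissible G (flux2 L) (rad2 L) (avg U i j) (avg U i (j + 1))
    (euler_lim2 gamma m H U i j).
Proof.
move=> /cell_eps_bounds[l1 l2 l3] /cell_eps_bounds[r1 r2 r3] a0.
have [|ler lep] := l3 (tilde2 L U i j); first by rewrite !inE eqxx !orbT.
apply: euler_face_admissible => //.
  by rewrite lt_min l1 r1 ge_min ler.
by rewrite lt_min l2 r2 ge_min lep.
Qed.

Lemma euler_step_in dt : 0 < dt -> stage_ok m L dt U ->
  all_in m 0 G (euler_step gamma m H dt U).
Proof.
have Gconv : convex_pred G.
  by move=> a b u v a0 b0 ab; apply: euler_G_convex.
move=> dt0 ok; split=> [i j ij|s s_in].
  have cin k l : k \in [:: i - 1; i; i + 1] -> l \in [:: j - 1; j; j + 1] ->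
      cell_in m 1 k l.
    by move: ij; rewrite !inE /cell_in; lia.
  have [[pos _] _ _] := ok; have [|aw ae as_ an] := pos i j.
    by rewrite /near_mesh ij.
  apply: (cell_update_in Gconv dt0 ok GU ij).
    move=> k k_i; apply: euler_lim1_admissible; last by case: k_i => ->.
      by apply: cin; rewrite !inE ?eqxx ?orbT //; lia.
    by apply: cin; rewrite !inE ?eqxx ?orbT //; lia.
  move=> k k_i; apply: euler_lim2_admissible; last by case: k_i => ->.
    by apply: cin; rewrite !inE ?eqxx ?orbT //; lia.
  by apply: cin; rewrite !inE ?eqxx ?orbT //; lia.
have Gst := point_stencil_in GU s_in.
apply: euler_point_limit => //; [|exact: eps_rho_gt0|exact: eps_p_gt0].
apply: point_low_in => //; first exact: euler_G_llf_state1.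
exact: euler_G_llf_state2.
Qed.
End EulerScheme.

Theorem proposition4p2 (R : realType) (m : mesh R) (dt : nat -> R)
    (dt_gt0 : forall n, 0 < dt n) :
  (forall (f1 f2 : R -> R) (u0 : R * R -> R) (m0 M0 : R)
      (H : high_order R) (cellN ptN : bounds_kind)
      (bc : nat -> nat -> dofs R -> dofs R) (U0 : dofs R),
    is_min (domain m) u0 m0 ->
    is_max (domain m) u0 M0 ->
    (forall u, scalar_G m0 M0 u -> derivable f1 u 1 /\ derivable f2 u 1) ->
    llf_speed_dominates (scalar_G m0 M0) (rad1 (scalar_law f1 f2)) ->
    llf_speed_dominates (scalar_G m0 M0) (rad2 (scalar_law f1 f2)) ->
    valid_bc m bc (scalar_G m0 M0) ->
    all_in m 0 (scalar_G m0 M0) U0 ->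
    let S := scalar_step f1 f2 m H cellN ptN in
    stages_ok m S bc dt U0 (scalar_law f1 f2) ->
    forall n, all_in m 0 (scalar_G m0 M0) (level S bc dt U0 n)) /\
  (forall (gamma : R) (H : high_order 'rV[R]_4)
      (bc : nat -> nat -> dofs 'rV[R]_4 -> dofs 'rV[R]_4)
      (U0 : dofs 'rV[R]_4),
    1 < gamma ->
    valid_bc m bc (euler_G gamma) ->
    all_in m 0 (euler_G gamma) U0 ->
    let S := euler_step gamma m H in
    stages_ok m S bc dt U0 (euler_law gamma) ->
    forall n, all_in m 0 (euler_G gamma) (level S bc dt U0 n)).
Proof.
split=> [f1 f2 u0 m0 M0 H cellN ptN bc U0 _ _ df dom1 dom2 bcG GU0 S ok n
        |gamma H bc U0 g1 bcG GU0 S ok n].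
  have df1 u : scalar_G m0 M0 u -> derivable f1 u 1 by case/df.
  have df2 u : scalar_G m0 M0 u -> derivable f2 u 1 by case/df.
  apply: (level_in (@scalar_G_convex _ m0 M0) dt_gt0 bcG _ _ GU0 ok).
  by move=> d U d0 okU GU; apply: (scalar_step_in df1 df2).
have Gconv : convex_pred (euler_G gamma).
  by move=> a b u v a0 b0 ab; apply: euler_G_convex.
apply: (level_in Gconv dt_gt0 bcG _ _ GU0 ok).
by move=> d U d0 okU GU; apply: euler_step_in.
Qed.
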